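(* Let $(X_t=N_t+A_t,\ t\ge 0)$ be a nonnegative, continuous local submartingale with $X_0=0$, where $N$ is its continuous local martingale part and $A$ its continuous increasing part. Then the following are equivalent: (1) $(X_t,\ t\ge 0)$ is of class $(\Sigma)$, i.e. the measure $(dA_t)$ is carried by the set $\{t: X_t=0\}$; (2) there exists a unique strictly positive, continuous local martingale $(M_t)$, with $M_0=1$, such that $$X_t=\frac{M_t}{I_t}-1,\qquad\text{where } I_t=\inf_{s\le t}M_s.$$ The local martingale $(M_t)$ is given by $$M_t=(1+X_t)\exp(-A_t).$$
   Context: All processes live on a filtered probability space $(\Omega,\mathcal{F},(\mathcal{F}_t)_{t\ge0},\mathbb{P})$ satisfying the usual assumptions. A nonnegative local submartingale $X$ with decomposition $X_t=N_t+A_t$ is said to be of class $(\Sigma)$ if: (i) $(N_t)$ is a continuous local martingale with $N_0=0$; (ii) $(A_t)$ is a continuous (adapted) increasing process with $A_0=0$; (iii) the measure $(dA_t)$ is carried by the set $\{t: X_t=0\}$. ''Increasing'' means nondecreasing, and uniqueness is up to indistinguishability. *)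

(* Defs.v *)
From HB Require Import structures.
From mathcomp Require Export all_boot all_order all_algebra.
From mathcomp Require Export all_classical all_reals all_analysis.
Export Order.TTheory GRing.Theory Num.Theory.
Export numFieldNormedType.Exports.

Set Implicit Arguments.
Unset Strict Implicit.
Unset Printing Implicit Defensive.

Local Open Scope classical_set_scope.
Local Open Scope ring_scope.

(* Conventions.  Time is R, but only the times t >= 0 are ever constrained, so
   the values of a process or of a filtration at negative times are
   irrelevant.  Path properties (continuity, monotonicity, positivity,
   equalities between processes) are required almost surely. *)

Definition process (R : realType) (T : Type) := R -> T -> R.

Record filtration (d : measure_display) (T : measurableType d) (R : realType)
    (F : R -> set (set T)) : Prop := Filtration {
  filtration_sigma_algebra : forall t, 0 <= t -> sigma_algebra setT (F t) ;
  filtration_measurable : forall t, 0 <= t -> F t `<=` measurable ;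
  filtration_le : forall s t, 0 <= s -> s <= t -> F s `<=` F t }.

(* F is right-continuous and F 0 contains every subset of a P-null event;
   since F 0 consists of events, the probability space is then complete. *)
Record usual_conditions (d : measure_display) (T : measurableType d)
    (R : realType) (P : probability T R) (F : R -> set (set T)) : Prop :=
  UsualConditions {
  usual_filtration : filtration F ;
  usual_right_continuous : forall t, 0 <= t ->
    \bigcap_(s in [set s | t < s]) F s = F t ;
  usual_complete : P.-negligible `<=` F 0 }.

Definition adapted (d : measure_display) (T : measurableType d) (R : realType)
    (F : R -> set (set T)) (X : process R T) : Prop :=
  forall t, 0 <= t -> g_sigma_algebra_preimage (X t) `<=` F t.

(* Z is a version of E[Y | G], for an integrable Y and a sub-sigma-algebra G *)
Definition is_cond_exp (d : measure_display) (T : measurableType d)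
    (R : realType) (P : probability T R) (G : set (set T)) (Y Z : T -> R) :
    Prop :=
  [/\ g_sigma_algebra_preimage Z `<=` G,
      P.-integrable setT (EFin \o Z)
    & forall B, G B ->
        (\int[P]_(w in B) (Z w)%:E = \int[P]_(w in B) (Y w)%:E)%E].

Definition martingale (d : measure_display) (T : measurableType d)
    (R : realType) (P : probability T R) (F : R -> set (set T))
    (X : process R T) : Prop :=
  [/\ adapted F X,
      forall t, 0 <= t -> P.-integrable setT (EFin \o X t)
    & forall s t, 0 <= s -> s <= t -> is_cond_exp P (F s) (X t) (X s)].

Definition submartingale (d : measure_display) (T : measurableType d)
    (R : realType) (P : probability T R) (F : R -> set (set T))
    (X : process R T) : Prop :=
  [/\ adapted F X,
      forall t, 0 <= t -> P.-integrable setT (EFin \o X t)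
    & forall s t, 0 <= s -> s <= t ->
        exists2 Z, is_cond_exp P (F s) (X t) Z &
                   \forall w \ae P, X s w <= Z w].

Definition stopping_time (d : measure_display) (T : measurableType d)
    (R : realType) (F : R -> set (set T)) (tau : T -> \bar R) : Prop :=
  (forall w, 0 <= tau w)%E /\
  forall t : R, 0 <= t -> F t [set w | (tau w <= t%:E)%E].

(* X_{t /\ tau}; the minimum is finite when 0 <= t and 0 <= tau *)
Definition stopped (T : Type) (R : realType) (X : process R T)
    (tau : T -> \bar R) : process R T :=
  fun t w => X (fine (mine t%:E (tau w))) w.

Definition localizing_sequence (d : measure_display) (T : measurableType d)
    (R : realType) (P : probability T R) (F : R -> set (set T))
    (tau : nat -> T -> \bar R) : Prop :=
  (forall n, stopping_time F (tau n)) /\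
  \forall w \ae P,
    (forall n, (tau n w <= tau n.+1 w)%E) /\
    (tau n w @[n --> \oo] --> +oo%E).

(* The initial values of the processes considered below are constants, so that
   subtracting X 0, or multiplying by the indicator of {0 < tau n}, in the
   localization would make no difference. *)
Definition local_martingale (d : measure_display) (T : measurableType d)
    (R : realType) (P : probability T R) (F : R -> set (set T))
    (X : process R T) : Prop :=
  adapted F X /\
  exists2 tau, localizing_sequence P F tau &
    forall n, martingale P F (stopped X (tau n)).

Definition local_submartingale (d : measure_display) (T : measurableType d)
    (R : realType) (P : probability T R) (F : R -> set (set T))
    (X : process R T) : Prop :=
  adapted F X /\
  exists2 tau, localizing_sequence P F tau &
    forall n, submartingale P F (stopped X (tau n)).

Definition continuous_process (d : measure_display) (T : measurableType d)
    (R : realType) (P : probability T R) (X : process R T) : Prop :=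
  \forall w \ae P, {within `[0, +oo[, continuous (X ^~ w)}.

Definition nonnegative_process (d : measure_display) (T : measurableType d)
    (R : realType) (P : probability T R) (X : process R T) : Prop :=
  \forall w \ae P, forall t, 0 <= t -> 0 <= X t w.

Definition positive_process (d : measure_display) (T : measurableType d)
    (R : realType) (P : probability T R) (X : process R T) : Prop :=
  \forall w \ae P, forall t, 0 <= t -> 0 < X t w.

Definition increasing_process (d : measure_display) (T : measurableType d)
    (R : realType) (P : probability T R) (X : process R T) : Prop :=
  \forall w \ae P, forall s t, 0 <= s -> s <= t -> X s w <= X t w.

Definition starts_at (d : measure_display) (T : measurableType d)
    (R : realType) (P : probability T R) (X : process R T) (x : R) : Prop :=
  \forall w \ae P, X 0 w = x.

Definition indistinguishable (d : measure_display) (T : measurableType d)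
    (R : realType) (P : probability T R) (X Y : process R T) : Prop :=
  \forall w \ae P, forall t, 0 <= t -> X t w = Y t w.

Definition continuous_local_martingale (d : measure_display)
    (T : measurableType d) (R : realType) (P : probability T R)
    (F : R -> set (set T)) (X : process R T) : Prop :=
  continuous_process P X /\ local_martingale P F X.

(* X = N + A, normalized by A 0 = 0 *)
Record decomposition (d : measure_display) (T : measurableType d)
    (R : realType) (P : probability T R) (F : R -> set (set T))
    (X N A : process R T) : Prop := Decomposition {
  decomposition_eq : indistinguishable P X (fun t w => N t w + A t w) ;
  decomposition_martingale : continuous_local_martingale P F N ;
  decomposition_adapted : adapted F A ;
  decomposition_continuous : continuous_process P A ;
  decomposition_increasing : increasing_process P A ;
  decomposition_0 : starts_at P A 0 }.

(* Almost surely, the Stieltjes measure dA gives no mass to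
   {t >= 0 | X t != 0}.  The Stieltjes measure of a path is that of its
   extension to R by the constant A 0 on the negative half-line; the
   existential only bundles this extension, which it determines, with the
   proofs of monotonicity and right-continuity. *)
Definition carried_by_zeros (d : measure_display) (T : measurableType d)
    (R : realType) (P : probability T R) (A X : process R T) : Prop :=
  \forall w \ae P, exists2 a : cumulative R R,
    (forall t, a t = A (Num.max 0 t) w) &
    lebesgue_stieltjes_measure a [set t | 0 <= t /\ X t w <> 0] = 0%E.

Record class_Sigma (d : measure_display) (T : measurableType d)
    (R : realType) (P : probability T R) (F : R -> set (set T))
    (X N A : process R T) : Prop := ClassSigma {
  class_Sigma_ge0 : nonnegative_process P X ;
  class_Sigma_submartingale : local_submartingale P F X ;
  class_Sigma_decomposition : decomposition P F X N A ;
  class_Sigma_N0 : starts_at P N 0 ;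
  class_Sigma_carried : carried_by_zeros P A X }.

Definition running_inf (T : Type) (R : realType) (M : process R T) :
    process R T :=
  fun t w => inf [set M s w | s in `[0, t]].

Record inf_representation (d : measure_display) (T : measurableType d)
    (R : realType) (P : probability T R) (F : R -> set (set T))
    (X M : process R T) : Prop := InfRepresentation {
  inf_representation_gt0 : positive_process P M ;
  inf_representation_martingale : continuous_local_martingale P F M ;
  inf_representation_1 : starts_at P M 1 ;
  inf_representation_eq :
    indistinguishable P X (fun t w => M t w / running_inf M t w - 1) }.

(* Main.v *)
(** Both implications rest on one pathwise computation.  Along a partition, with
    [x >= 0] and [l] nondecreasing, the increments of [(1 + x) e^(-l)] and of
    [x - l] satisfy
      [D((1 + x) e^(-l)) = e^(-l) (D(x - l) + r)],
      [r = Dl - (1 + x') (1 - e^(-Dl))],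
    where [x'] is the value of [x] at the right end of the cell; if [dl] is
    carried by the zeros of [x], then a cell with [Dl > 0] contains a zero of [x],
    so [x'] is at most the oscillation of [x] and [sum |r|] tends to [0].  Hence
    [(1 + X) e^(-A)] is a limit of martingale transforms of [X - A], and
    conversely; no stochastic integral is needed.  Boundedness is obtained by
    stopping, which requires optional stopping for continuous martingales.

    If [dA] is carried by [{X = 0}], then [M = (1 + X) e^(-A)] is therefore a
    local martingale, and its running infimum is [e^(-A)].  Conversely, if
    [X = M / I - 1] and [L = - ln I], then [dL] is carried by [{M = I} = {X = 0}]
    and [M = (1 + X) e^(-L)], so [X - L] is a local martingale.  Then [A - L] is a
    continuous local martingale of finite variation; its square is a local
    martingale because its quadratic sums vanish, so [A = L]. *)

From HB Require Import structures.
Require Import Defs.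
From mathcomp Require Import measurable_realfun ring lra.

Set Implicit Arguments.
Unset Strict Implicit.
Unset Printing Implicit Defensive.

Local Open Scope classical_set_scope.
Local Open Scope ring_scope.

(** * Paths and uniform partitions *)

(** Limits of transforms are taken by dominated convergence, so every convergence statement on
    Riemann sums is paired with a bound uniform in the partition. Such bounds hold only while the
    processes are bounded, and they are secured by stopping when a sum of two nonnegative processes,
    [X + L] or [A + L], reaches a level: a bound on the sum bounds each term.

    Paths are continuous only almost surely. Stopped values and hitting events are therefore
    described through countably many grid times, which gives measurability up to a null event, and
    completeness of [F] absorbs that event.

    Uniqueness of [M] costs nothing more: once [A = L] is known, every representing [M] equals
    [(1 + X) e^(-A)]. *)

Section paths.
Context {R : realType}.
Implicit Types (f x l : R -> R) (s t : R).

Lemma continuous_max0 : continuous (Num.max 0 : R -> R).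
Proof. by move=> u; apply: continuous_max; [exact: cst_continuous|exact: cvg_id]. Qed.

(** Freezing a path at its value at [0] for negative times turns continuity on the half-line into
    continuity on [R], so the pathwise lemmas can avoid subspace topologies. *)
Lemma continuous_within_nonneg f :
  {within `[0, +oo[, continuous f} <-> continuous (f \o Num.max 0).
Proof.
split=> [cf u|cf].
  apply/(@cvgrPdist_lt _ R^o) => e e0 /=.
  have m0 : `[0, +oo[%classic (Num.max 0 u) by rewrite /= in_itv/= andbT le_max lexx.
  move/subspace_continuousP : cf => /(_ _ m0) /(@cvgrPdist_lt _ R^o) /(_ _ e0).
  rewrite near_withinE => H.
  have {}H : \forall v \near u, Num.max 0 v \in `[0, +oo[ ->
      `|f (Num.max 0 u) - f (Num.max 0 v)| < e := continuous_max0 H.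
  by apply: filterS H => v /=; apply; rewrite in_itv/= andbT le_max lexx.
apply: (@subspace_eq_continuous _ _ _ (f \o Num.max 0)).
  by move=> u; rewrite inE/= in_itv/= andbT => u0; rewrite max_r.
exact: continuous_subspaceT.
Qed.

Lemma continuous_segment f s t : 0 <= s ->
  continuous (f \o Num.max 0) -> {within `[s, t], continuous f}.
Proof.
move=> s0 /continuous_within_nonneg; apply: continuous_subspaceW => u/=.
by rewrite !in_itv/= andbT => /andP[su _]; exact: le_trans su.
Qed.

(** Heine's theorem, with the modulus expressed by the mesh. Only [u] is confined to the compact
    interval; [v] may lie outside it. *)
Lemma uniform_mesh f (a b c e : R) : continuous f -> 0 < e ->
  \forall k \near \oo, forall u v, a <= u <= b -> `|u - v| <= c / k.+1%:R ->
    `|f u - f v| < e.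
Proof.
move=> cf e0.
have /(_ nat \oo
  (fun k u => forall v, `|u - v| <= c / k.+1%:R -> `|f u - f v| < e) _)[] :=
  (compact_near_coveringP _).1 (@segment_compact R a b).
  move=> u _.
  have /(@cvgrPdist_lt _ R^o) /(_ _ (divr_gt0 e0 (ltr0Sn R 1))) := cf u.
  move=> /nbhs_ballP[r /= r0 Hr].
  have r2 : 0 < r / 2 by rewrite divr_gt0.
  have h0 : c / k.+1%:R @[k --> \oo] --> (0 : R).
    by rewrite -[0](mulr0 c); apply: cvgM; [exact: cvg_cst|exact: cvg_harmonic].
  have /(@cvgr_dist_lt _ R^o) /(_ _ r2) hk := h0.
  exists (ball u (r / 2), [set k : nat | `|0 - c / k.+1%:R| < r / 2]) => /=.
    by split => //=; exact: nbhsx_ballx.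
  move=> [v k] /= [uv hck] w vw.
  have Huw : `|u - w| < r.
    rewrite -(subrKA v) (le_lt_trans (ler_normD _ _))// [ltRHS]splitr ltrD//.
    by rewrite (le_lt_trans vw)// (le_lt_trans _ hck)// sub0r normrN ler_norm.
  have uv' : `|u - v| < r by move: uv; rewrite -ball_normE /=; lra.
  have /= := Hr _ uv'; have /= := Hr _ Huw.
  rewrite !ltr_norml; lra.
by move=> n _ H; exists n => // k nk u v uab; apply: (H k nk); rewrite /= in_itv.
Qed.

(* Uniform partition of [s, t] into k + 1 cells, with points i = 0, ..., k + 1. *)
Definition grid s t (k i : nat) : R := s + (t - s) * (i%:R / k.+1%:R).

Lemma grid0 s t k : grid s t k 0 = s.
Proof. by rewrite /grid mul0r mulr0 addr0. Qed.

Lemma gridS s t k : grid s t k k.+1 = t.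
Proof. by rewrite /grid divff// mulr1 subrKC. Qed.

Lemma grid_le s t k i j : s <= t -> (i <= j)%N -> grid s t k i <= grid s t k j.
Proof.
move=> st ij; rewrite /grid lerD2l ler_wpM2l ?subr_ge0//.
by rewrite ler_wpM2r ?invr_ge0// ler_nat.
Qed.

Lemma grid_ge s t k i : s <= t -> s <= grid s t k i.
Proof. by move=> st; rewrite -[leLHS](grid0 s t k) grid_le. Qed.

Lemma grid_leT s t k i : s <= t -> (i <= k.+1)%N -> grid s t k i <= t.
Proof. by move=> st ik; rewrite -[leRHS](gridS s t k) grid_le. Qed.

Lemma grid_step s t k i : grid s t k i.+1 - grid s t k i = (t - s) / k.+1%:R.
Proof. by rewrite /grid -natr1; field. Qed.

Lemma uniform_grid f s t e : 0 <= s -> s <= t -> continuous (f \o Num.max 0) ->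
  0 < e -> \forall k \near \oo, forall i u v, (i <= k)%N ->
    grid s t k i <= u <= grid s t k i.+1 ->
    grid s t k i <= v <= grid s t k i.+1 -> `|f u - f v| < e.
Proof.
move=> s0 st cf e0; have := uniform_mesh s t (t - s) cf e0.
apply: filterS => k H i u v ik /andP[iu ui] /andP[iv vi].
have su : s <= u by rewrite (le_trans _ iu)// grid_ge.
have sv : s <= v by rewrite (le_trans _ iv)// grid_ge.
have := H u v; rewrite /= !max_r ?(le_trans s0)//; apply.
  by rewrite su (le_trans ui)// grid_leT.
rewrite -(grid_step s t k i) ler_norml; lra.
Qed.

Lemma sum_grid f s t k :
  \sum_(i < k.+1) (f (grid s t k i.+1) - f (grid s t k i)) = f t - f s.
Proof.
rewrite -(big_mkord xpredT (fun i => f (grid s t k i.+1) - f (grid s t k i))).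
by rewrite telescope_sumr// gridS grid0.
Qed.

End paths.

(** * Left-endpoint Riemann sums of paths *)

Section riemann_sums.
Context {R : realType}.
Implicit Types (f x l : R -> R) (s t : R).

(* Pathwise form of "dl is carried by the zeros of x" that involves no measure
   and is inherited by stopped paths. *)
Definition increments_touch_zero x l := forall u v : R, 0 <= u -> u <= v ->
  l u < l v -> exists2 z, u <= z <= v & x z = 0.

(** The integrand is taken at the left end of each cell, so that for adapted [v] and a martingale
    [y] this is a martingale transform. *)
Definition riemann_sum (v y : R -> R) s t k :=
  \sum_(i < k.+1) v (grid s t k i) * (y (grid s t k i.+1) - y (grid s t k i)).

(** [u - (1 - e^(-u))] lies in [[0, u^2]] and [x (1 - e^(-u))] in [[0, x u]]. With [u] an increment
    and [x] at most an oscillation, both are small compared with [u]. *)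
Lemma exp_remainder_le (x u : R) : 0 <= x -> 0 <= u ->
  `|u - (1 + x) * (1 - expR (- u))| <= u * u + x * u.
Proof.
move=> x0 u0.
have h1 := expR_ge1Dx (- u); have h2 := expR_ge1Dx u.
have h3 : expR (- u) * expR u = 1 by rewrite -expRD addNr expR0.
have h4 : expR (- u) * (1 + u) <= 1 by rewrite -[leRHS]h3 ler_wpM2l ?expR_ge0.
have h5 := expR_gt0 (- u).
have h6 : expR (- u) <= 1 by rewrite expR_le1; lra.
rewrite ler_norml; nra.
Qed.

Let cvg_cstB (a : R) (f : R^nat) :
  f k @[k --> \oo] --> (0 : R) -> (a - f k) @[k --> \oo] --> a.
Proof.
move=> f0; rewrite -[X in _ --> X]subr0.
by apply: (@cvgB _ R^o) => //; exact: cvg_cst.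
Qed.

Let cvg_cstD (a : R) (f : R^nat) :
  f k @[k --> \oo] --> (0 : R) -> (a + f k) @[k --> \oo] --> a.
Proof.
move=> f0; rewrite -[X in _ --> X]addr0.
by apply: (@cvgD _ R^o) => //; exact: cvg_cst.
Qed.

Section remainder.
Variables (x l : R -> R).
Hypotheses (x_ge0 : forall u : R, 0 <= u -> 0 <= x u)
  (x_cont : continuous (x \o Num.max 0)) (l_cont : continuous (l \o Num.max 0))
  (l_nd : forall u v : R, 0 <= u -> u <= v -> l u <= l v)
  (xl : increments_touch_zero x l).

Let rem s t k (i : nat) :=
  l (grid s t k i.+1) - l (grid s t k i) -
  (1 + x (grid s t k i.+1)) * (1 - expR (- (l (grid s t k i.+1) - l (grid s t k i)))).

(** A cell contributes at most [u + (1 + x) u <= (2 + K) u], with [u] the increment of [l], and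
    these increments telescope. The weights [c] are [e^(-l)] in one identity below and [1] in the
    other. *)
Lemma remainder_bounded (K : R) s t (c : nat -> nat -> R) k :
  0 <= s -> s <= t -> (forall k i, `|c k i| <= 1) ->
  (forall u : R, s <= u <= t -> x u <= K) ->
  `|\sum_(i < k.+1) c k i * rem s t k i| <= (2 + K) * (l t - l s).
Proof.
move=> s0 st c1 xK; rewrite -(sum_grid l s t k) mulr_sumr.
apply: le_trans (ler_norm_sum _ _ _) _; apply: ler_sum => i _.
rewrite normrM (le_trans (ler_wpM2r _ (c1 _ _)))// mul1r /rem.
have gi : 0 <= grid s t k i by rewrite (le_trans s0)// grid_ge.
have gi1 : 0 <= grid s t k i.+1 by rewrite (le_trans s0)// grid_ge.
have x0 := x_ge0 gi1.
have d0 : 0 <= l (grid s t k i.+1) - l (grid s t k i) by rewrite subr_ge0 l_nd// grid_le.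
have xK' : x (grid s t k i.+1) <= K by rewrite xK// grid_ge//= grid_leT.
move: (l _ - l _) d0 => u d0.
have h1 := expR_ge1Dx (- u).
have h6 : expR (- u) <= 1 by rewrite expR_le1 oppr_le0.
move: h1 h6; set g := expR _ => h1 h6.
have p1 : 0 <= (1 + x (grid s t k i.+1)) * (g - 1 + u) by rewrite mulr_ge0; lra.
have p2 : 0 <= (1 + x (grid s t k i.+1)) * (1 - g) by rewrite mulr_ge0; lra.
have p3 : 0 <= (K - x (grid s t k i.+1)) * u by rewrite mulr_ge0; lra.
have p4 : 0 <= x (grid s t k i.+1) * u by rewrite mulr_ge0.
by rewrite ler_norml; nra.
Qed.

Lemma remainder_cvg0 s t (c : nat -> nat -> R) :
  0 <= s -> s <= t -> (forall k i, `|c k i| <= 1) ->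
  (\sum_(i < k.+1) c k i * rem s t k i) @[k --> \oo] --> (0 : R).
Proof.
move=> s0 st c1; apply/(@cvgr0Pnorm_le _ R^o) => e e0.
have lst : 0 <= l t - l s by rewrite subr_ge0 l_nd.
(* The total will be at most [2 e'] times the increment of [l]; the [1 +] prevents a division by
   zero when [l t = l s]. *)
pose e' := e / (2 * (1 + (l t - l s))).
have e'0 : 0 < e' by rewrite divr_gt0// mulr_gt0//; lra.
have H1 := uniform_grid s0 st x_cont e'0.
have H2 := uniform_grid s0 st l_cont e'0.
apply: filterS2 H1 H2 => k H1 H2.
suff : `|\sum_(i < k.+1) c k i * rem s t k i| <= (2 * e') * (l t - l s).
  move=> /le_trans; apply; rewrite /e' invfM.
  have -> : 2 * (e * (2^-1 / (1 + (l t - l s)))) * (l t - l s) =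
    e * ((l t - l s) / (1 + (l t - l s))) by field; lra.
  by rewrite ler_piMr ?(ltW e0)// ler_pdivrMr ?mul1r; lra.
rewrite -(sum_grid l s t k) mulr_sumr.
apply: le_trans (ler_norm_sum _ _ _) _; apply: ler_sum => i _.
rewrite normrM (le_trans (ler_wpM2r _ (c1 _ _)))// mul1r /rem.
have gi : 0 <= grid s t k i by rewrite (le_trans s0)// grid_ge.
have gi1 : 0 <= grid s t k i.+1 by rewrite (le_trans s0)// grid_ge.
have gg := grid_le k st (leqnSn i).
have ik : (i <= k)%N by rewrite -ltnS.
have x0 := x_ge0 gi1.
have d0 := l_nd gi gg.
have d0' := d0; rewrite -subr_ge0 in d0'.
move: (d0); rewrite le_eqVlt => /orP[/eqP lE|lt].
  by rewrite lE subrr oppr0 expR0 !subrr !mulr0 subrr normr0.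
have [z zi xz] := xl gi gg lt.
have := H1 i (grid s t k i.+1) z ik; rewrite gg lexx => /(_ isT zi).
rewrite xz subr0 (ger0_norm x0) => xe.
have := H2 i (grid s t k i.+1) (grid s t k i) ik; rewrite gg !lexx => /(_ isT isT).
rewrite (ger0_norm d0') => le.
move: d0' le; move: (l _ - l _) => u u0 le.
rewrite (le_trans (exp_remainder_le x0 u0))//.
by rewrite -mulrDl ler_wpM2r//; lra. Qed.

Lemma riemann_sum_expN s t k : (forall u : R, 0 <= u -> 0 <= l u) ->
  riemann_sum (fun u => expR (- l u)) (fun u => x u - l u) s t k =
  (1 + x t) * expR (- l t) - (1 + x s) * expR (- l s) -
  \sum_(i < k.+1) expR (- l (grid s t k i)) * rem s t k i.
Proof.
move=> l0.
rewrite -(sum_grid (fun u => (1 + x u) * expR (- l u)) s t k) -sumrB.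
apply: eq_bigr => i _; rewrite /rem.
have -> : expR (- l (grid s t k i.+1)) = expR (- l (grid s t k i)) *
  expR (- (l (grid s t k i.+1) - l (grid s t k i))) by rewrite -expRD; congr expR; ring.
by ring.
Qed.

Lemma riemann_sum_exp s t k :
  riemann_sum (fun u => expR (l u)) (fun u => (1 + x u) * expR (- l u)) s t k =
  (x t - l t) - (x s - l s) + \sum_(i < k.+1) 1 * rem s t k i.
Proof.
rewrite -(sum_grid (fun u => x u - l u) s t k) -big_split.
apply: eq_bigr => i _; rewrite /rem /=.
have -> : expR (- l (grid s t k i.+1)) = expR (- l (grid s t k i)) *
  expR (- (l (grid s t k i.+1) - l (grid s t k i))) by rewrite -expRD; congr expR; ring.
have : expR (l (grid s t k i)) * expR (- l (grid s t k i)) = 1 by rewrite -expRD subrr expR0.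
set a := expR (l _); set b := expR (- l _) => ab; set g := expR _.
have -> : a * ((1 + x (grid s t k i.+1)) * (b * g) - (1 + x (grid s t k i)) * b) =
  a * b * ((1 + x (grid s t k i.+1)) * g - (1 + x (grid s t k i))) by ring.
by rewrite ab; ring.
Qed.

Lemma riemann_sum_expN_cvg s t : (forall u : R, 0 <= u -> 0 <= l u) ->
  0 <= s -> s <= t ->
  riemann_sum (fun u => expR (- l u)) (fun u => x u - l u) s t k @[k --> \oo] -->
    (1 + x t) * expR (- l t) - (1 + x s) * expR (- l s).
Proof.
move=> l0 s0 st; under eq_fun do rewrite riemann_sum_expN//.
apply: cvg_cstB.
pose c (k i : nat) := if (i <= k.+1)%N then expR (- l (grid s t k i)) else 0.
rewrite (_ : (fun _ => _) = fun k => \sum_(i < k.+1) c k i * rem s t k i).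
  apply: remainder_cvg0 => // k i; rewrite /c; case: ifP; rewrite ?normr0// => _.
  by rewrite ger0_norm ?expR_ge0// expR_le1 oppr_le0 l0// (le_trans s0)// grid_ge.
by apply/funext => k; apply: eq_bigr => i _; rewrite /c ltnW.
Qed.

(** Two endpoint values of size at most [1 + K], plus the bound on the weighted remainders. *)
Lemma riemann_sum_expN_bounded (K : R) s t k : (forall u : R, 0 <= u -> 0 <= l u) ->
  0 <= s -> s <= t -> (forall u : R, s <= u <= t -> x u <= K) -> l t <= K ->
  `|riemann_sum (fun u => expR (- l u)) (fun u => x u - l u) s t k| <=
  2 * (1 + K) + (2 + K) * K.
Proof.
move=> l0 s0 st xK lK; rewrite riemann_sum_expN//.
have t0 := le_trans s0 st.
have H : `|\sum_(i < k.+1) expR (- l (grid s t k i)) * rem s t k i| <= (2 + K) * (l t - l s).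
  pose c (k i : nat) := if (i <= k.+1)%N then expR (- l (grid s t k i)) else 0.
  rewrite (eq_bigr (fun i : 'I_k.+1 => c k i * rem s t k i)); last by move=> i _; rewrite /c ltnW.
  apply: remainder_bounded => // k' i; rewrite /c; case: ifP; rewrite ?normr0// => _.
  by rewrite ger0_norm ?expR_ge0// expR_le1 oppr_le0 l0// (le_trans s0)// grid_ge.
have [x0 xs0] := (x_ge0 t0, x_ge0 s0).
have [xt xs] : x t <= K /\ x s <= K by rewrite !xK ?lexx ?st.
have [e0 e1] : 0 < expR (- l t) /\ expR (- l t) <= 1 by rewrite expR_gt0 expR_le1 oppr_le0 l0.
have [f0 f1] : 0 < expR (- l s) /\ expR (- l s) <= 1 by rewrite expR_gt0 expR_le1 oppr_le0 l0.
have ls := l0 _ s0; have lst := l_nd s0 st.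
move: H; rewrite !ler_norml; nra.
Qed.

Lemma riemann_sum_exp_cvg s t : 0 <= s -> s <= t ->
  riemann_sum (fun u => expR (l u)) (fun u => (1 + x u) * expR (- l u)) s t k @[k --> \oo] -->
    (x t - l t) - (x s - l s).
Proof.
move=> s0 st; under eq_fun do rewrite riemann_sum_exp//.
apply: cvg_cstD.
by apply: (@remainder_cvg0 s t (fun _ _ => 1)) => // k i; rewrite normr1.
Qed.

(** The four endpoint terms are each at most [K]; the rest bounds the remainders. *)
Lemma riemann_sum_exp_bounded (K : R) s t k : (forall u : R, 0 <= u -> 0 <= l u) ->
  0 <= s -> s <= t -> (forall u : R, s <= u <= t -> x u <= K) -> l t <= K ->
  `|riemann_sum (fun u => expR (l u)) (fun u => (1 + x u) * expR (- l u)) s t k| <=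
  4 * K + (2 + K) * K.
Proof.
move=> l0 s0 st xK lK; rewrite riemann_sum_exp//.
have t0 := le_trans s0 st.
have c1 (k' i : nat) : `|1 : R| <= 1 by rewrite normr1.
have H := @remainder_bounded K s t (fun _ _ => 1) k s0 st c1 xK.
have [x0 xs0] := (x_ge0 t0, x_ge0 s0).
have [xt xs] : x t <= K /\ x s <= K by rewrite !xK ?lexx ?st.
have ls := l0 _ s0; have lst := l_nd s0 st; clear c1.
move: H; rewrite !ler_norml; nra.
Qed.

End remainder.

(** * Quadratic sums of paths of finite variation *)

Section quadratic.
Variables (y a b : R -> R) (K : R).
Hypotheses (y_cont : continuous (y \o Num.max 0))
  (ab : forall u : R, 0 <= u -> y u = a u - b u)
  (a_nd : forall u v : R, 0 <= u -> u <= v -> a u <= a v)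
  (b_nd : forall u v : R, 0 <= u -> u <= v -> b u <= b v).

Let q s t k := \sum_(i < k.+1) (y (grid s t k i.+1) - y (grid s t k i)) ^+ 2.

Let riemann_sum_self s t k :
  riemann_sum y y s t k = (y t ^+ 2 / 2 - y s ^+ 2 / 2) - q s t k / 2.
Proof.
rewrite -(sum_grid (fun u => y u ^+ 2 / 2) s t k) /q mulr_suml -sumrB.
by apply: eq_bigr => i _; field.
Qed.

Let norm_increment u v : 0 <= u -> u <= v ->
  `|y v - y u| <= (a v + b v) - (a u + b u).
Proof.
move=> u0 uv; rewrite !ab ?(le_trans u0)//.
have h1 := a_nd u0 uv; have h2 := b_nd u0 uv.
by rewrite ler_norml; lra.
Qed.

(** One factor of each square is bounded by [e], the other by the increment of [a + b], which
    telescopes. *)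
Let quadratic_le e s t k : 0 <= s -> s <= t -> (forall i, (i <= k)%N ->
  `|y (grid s t k i.+1) - y (grid s t k i)| <= e) ->
  q s t k <= e * ((a t + b t) - (a s + b s)).
Proof.
move=> s0 st H; rewrite -(sum_grid (fun u => a u + b u) s t k) mulr_sumr.
apply: ler_sum => i _; rewrite -real_normK ?num_real// expr2 ler_pM//.
  by rewrite H// -ltnS.
apply: norm_increment; first by rewrite (le_trans s0)// grid_ge.
exact: grid_le.
Qed.

Lemma riemann_sum_self_cvg s t : 0 <= s -> s <= t ->
  riemann_sum y y s t k @[k --> \oo] --> y t ^+ 2 / 2 - y s ^+ 2 / 2.
Proof.
move=> s0 st; under eq_fun do rewrite riemann_sum_self.
apply: cvg_cstB.
rewrite -(mul0r (2^-1)); apply: cvgM; last exact: cvg_cst.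
apply/(@cvgr0Pnorm_le _ R^o) => e e0.
have V0 : 0 <= (a t + b t) - (a s + b s).
  by have h1 := a_nd s0 st; have h2 := b_nd s0 st; lra.
pose e' := e / (1 + ((a t + b t) - (a s + b s))).
have e'0 : 0 < e' by rewrite divr_gt0//; lra.
apply: filterS (uniform_grid s0 st y_cont e'0) => k H.
rewrite ger0_norm; last by apply: sumr_ge0 => i _; exact: sqr_ge0.
rewrite (le_trans (@quadratic_le e' s t k s0 st _))//.
  move=> i ik; apply/ltW/(H i) => //; rewrite ?lexx ?andbT;
  by rewrite grid_le.
rewrite /e'.
by rewrite mulrAC -mulrA ler_piMr ?(ltW e0)// ler_pdivrMr ?mul1r; lra.
Qed.

Lemma riemann_sum_self_bounded s t k : 0 <= s -> s <= t ->
  (forall u : R, s <= u <= t -> `|y u| <= K) ->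
  (a t + b t) - (a s + b s) <= K ->
  `|riemann_sum y y s t k| <= K ^+ 2 * 2.
Proof.
move=> s0 st yK abK.
have V0 : 0 <= (a t + b t) - (a s + b s).
  by have h1 := a_nd s0 st; have h2 := b_nd s0 st; lra.
rewrite riemann_sum_self.
have q0 : 0 <= q s t k by apply: sumr_ge0 => i _; exact: sqr_ge0.
have H : q s t k <= (2 * K) * ((a t + b t) - (a s + b s)).
  apply: quadratic_le => // i ik.
  rewrite (le_trans (ler_normB _ _))//.
  have -> : 2 * K = K + K by lra.
  rewrite lerD ?yK ?grid_ge ?grid_leT//.
  by rewrite ltnW.
have h1 : `|y t| <= K by rewrite yK// lexx st.
have h2 : `|y s| <= K by rewrite yK// lexx st.
move: h1 h2; rewrite !ler_norml; nra.
Qed.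

End quadratic.
End riemann_sums.

(** * Measurability with respect to a sub-sigma-algebra *)

Section sub_sigma_algebra.
Context {d : measure_display} {T : measurableType d} {R : realType}
  (P : probability T R).
Implicit Types (G : set (set T)) (f g h : T -> R).

(** This puts [G] on the carrier of [T] as its own measurable structure, so the usual closure
    properties of measurable functions apply to adapted processes. *)
Lemma sub_measurableP G f : sigma_algebra setT G ->
  g_sigma_algebra_preimage f `<=` G <->
  measurable_fun setT (f : g_sigma_algebraType G -> R).
Proof.
move=> sG; rewrite /g_sigma_algebra_preimage; split.
  by move=> fG _ B mB; rewrite measurable_g_measurableTypeE//; apply: fG; exists B.
by move=> mf _ [B mB <-]; have := mf measurableT _ mB; rewrite measurable_g_measurableTypeE.
Qed.

Lemma sub_measurable_preimage G f B : g_sigma_algebra_preimage f `<=` G ->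
  measurable B -> G (f @^-1` B).
Proof. by move=> fG mB; apply: fG; exists B => //; rewrite setTI. Qed.

Lemma sub_measurable_fun G f : G `<=` measurable ->
  g_sigma_algebra_preimage f `<=` G -> measurable_fun setT f.
Proof. by move=> GM fG _ B mB; apply: GM; apply: fG; exists B. Qed.

Lemma sub_measurable_leq G1 G2 f : G1 `<=` G2 ->
  g_sigma_algebra_preimage f `<=` G1 -> g_sigma_algebra_preimage f `<=` G2.
Proof. by move=> G12 fG; exact: subset_trans G12. Qed.

Section complete.
Variable G : set (set T).
Hypotheses (sG : sigma_algebra setT G) (cG : P.-negligible `<=` G).

Let GI A B : G A -> G B -> G (A `&` B).
Proof.
by rewrite -[G](measurable_g_measurableTypeE sG); exact: measurableI.
Qed.

Let GU A B : G A -> G B -> G (A `|` B).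
Proof.
by rewrite -[G](measurable_g_measurableTypeE sG); exact: measurableU.
Qed.

Let GC A : G A -> G (~` A).
Proof.
by rewrite -[G](measurable_g_measurableTypeE sG); exact: measurableC.
Qed.

(** Off the exceptional set [N] the two sets agree; the part of [B] inside [N] is negligible, hence
    in [G]. *)
Lemma sub_ae_eq_set A B : G A -> (\forall w \ae P, A w <-> B w) -> G B.
Proof.
move=> GA AB; pose N := ~` [set w | A w <-> B w].
have -> : B = (A `&` ~` N) `|` (B `&` N).
  apply/seteqP; split=> [w Bw|w [[Aw]|[]//]].
    have [ABw|Nw] := pselect (A w <-> B w); last first.
      by right; split => //; exact: Nw.
    by left; split; [exact/ABw|move=> /(_ ABw)].
  by move=> /contrapT[+ _]; exact.
apply: GU.
  by apply: GI => //; apply: GC; exact: cG.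
by apply: cG; apply: negligibleS AB => w [].
Qed.

Lemma sub_ae_eq f g : g_sigma_algebra_preimage f `<=` G ->
  (\forall w \ae P, f w = g w) -> g_sigma_algebra_preimage g `<=` G.
Proof.
move=> fG fg _ [B mB <-]; rewrite setTI.
apply: (@sub_ae_eq_set (f @^-1` B)); first exact: sub_measurable_preimage.
by apply: filterS fg => w /= ->.
Qed.

(** Replacing [f] by [0] on the exceptional set gives a true pointwise limit off that set;
    completeness then restores [f]. *)
Lemma sub_ae_cvg (f_ : (T -> R)^nat) f :
  (forall n, g_sigma_algebra_preimage (f_ n) `<=` G) ->
  (\forall w \ae P, f_ n w @[n --> \oo] --> f w) ->
  g_sigma_algebra_preimage f `<=` G.
Proof.
move=> fG fcv; pose N := ~` [set w | f_ n w @[n --> \oo] --> f w].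
have GN : G N by exact: cG.
pose T' := g_sigma_algebraType G.
have mE : @measurable _ T' = G := measurable_g_measurableTypeE sG.
have mN : @measurable _ T' (~` N) by rewrite mE; exact: GC.
have mg : measurable_fun setT (f \_ (~` N) : T' -> R).
  apply: (measurable_restrictT _ mN).1.
  apply: (@measurable_fun_cvg _ T' R (~` N) f_) => [n|w /contrapT//].
  by apply: measurable_funTS; apply/sub_measurableP.
have /sub_ae_eq : g_sigma_algebra_preimage (f \_ (~` N)) `<=` G by apply/sub_measurableP.
apply; apply: filterS fcv => w cw.
by rewrite patchE mem_set//= /N /= => /(_ cw).
Qed.

End complete.

Lemma ae_le_integrable D (f g : T -> R) : measurable D -> measurable_fun D f ->
  P.-integrable D (EFin \o g) -> (\forall w \ae P, D w -> `|f w| <= g w) ->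
  P.-integrable D (EFin \o f).
Proof.
move=> mD mf /integrableP[mg ig] fg; apply/integrableP; split.
  exact/measurable_EFinP.
apply: le_lt_trans ig; apply: ae_ge0_le_integral => //.
- by apply: measurableT_comp => //; exact/measurable_EFinP.
- exact: measurableT_comp.
- apply: filterS fg => w H Dw /=; rewrite lee_fin.
  by rewrite (le_trans (H Dw))// ler_norm.
Qed.

Lemma ae_bounded_integrable (f : T -> R) (K : R) : measurable_fun setT f ->
  (\forall w \ae P, `|f w| <= K) -> P.-integrable setT (EFin \o f).
Proof.
move=> mf fK; apply: (@ae_le_integrable _ f (cst K)) => //.
  exact: finite_measure_integrable_cst.
by apply: filterS fK => w.
Qed.

Import HBNNSimple.

(* That is, E[h D | G] = h E[D | G] when E[D | G] = 0. *)
Lemma integral_bounded_orthogonal G D h (K : R) :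
  sigma_algebra setT G -> G `<=` measurable ->
  P.-integrable setT (EFin \o D) ->
  (forall B, G B -> (\int[P]_(w in B) (D w)%:E = 0)%E) ->
  g_sigma_algebra_preimage h `<=` G ->
  (\forall w \ae P, `|h w| <= K) ->
  P.-integrable setT (EFin \o (h \* D)) /\
  forall B, G B -> (\int[P]_(w in B) (h w * D w)%:E = 0)%E.
Proof.
move=> sG GM iD D0 hG hK.
have mh := sub_measurable_fun GM hG.
have mD : measurable_fun setT D by exact/measurable_EFinP/(measurable_int P).
have ihD : P.-integrable setT (EFin \o (h \* D)).
  apply: (@ae_le_integrable _ _ (fun w => K * `|D w|)) => //.
  - exact: measurable_funM.
  - by apply: (integrableZl measurableT K (f := abse \o (EFin \o D))) => //; exact: integrable_abse.
  - by apply: filterS hK => w hw _ /=; rewrite normrM ler_wpM2r.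
split=> // B GB.
pose T' := g_sigma_algebraType G.
have mE : @measurable _ T' = G := measurable_g_measurableTypeE sG.
(* [h + K] clipped to [[0, 2 K]]: nonnegative and bounded everywhere, hence an increasing limit of
   simple functions, and almost surely equal to [h + K]. *)
pose h' w := Num.max 0 (Num.min (K + K) (h w + K)).
have mh' : measurable_fun setT (EFin \o h' : T' -> \bar R).
  apply/measurable_EFinP; apply: measurable_maxr => //; apply: measurable_minr => //.
  by apply: measurable_funD => //; exact/sub_measurableP.
have mB : measurable B := GM _ GB.
have iB : P.-integrable B (EFin \o D) by exact: integrableS iD.
pose phi := nnsfun_approx (@measurableT _ T') mh'.
have mphi n : measurable_fun setT (phi n : T -> R).
  by apply: (@sub_measurable_fun G) => //; exact/sub_measurableP.
have phi0 n : (\int[P]_(w in B) (phi n w * D w)%:E = 0)%E.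
  (* The level sets are in [G], so the integral of [phi n * D] over [B] is a combination of
     integrals of [D] over the sets [B] meets in them, all zero. *)
  pose C (y : R) : set T := [set w | phi n w = y].
  have [s sE] : exists s : seq R, forall w : T, phi n w = \sum_(y <- s) y * \1_(C y) w.
    by eexists => w; rewrite fimfunE fsbig_finite//=; reflexivity.
  have GC i : G (C i).
    by apply: (@sub_measurable_preimage G (phi n) [set i]) => //; exact/sub_measurableP.
  rewrite (eq_integral (fun w : T => (\sum_(i <- s) (i%:E * ((EFin \o D) \_ (C i)) w))%E)); last first.
    move=> w _; rewrite sE mulr_suml -sumEFin; apply: eq_bigr => i _.
    rewrite -mulrA EFinM; congr (_ * _)%E; rewrite patchE indicE.
    by case: (w \in C i); rewrite ?mul1r ?mul0r.
  have iC i : P.-integrable B ((EFin \o D) \_ (C i)).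
    apply: (integrableS measurableT) => //.
    apply: (integrable_mkcond _ (GM _ (GC i))).1.
    by apply: integrableS iD => //; exact: GM.
  rewrite integral_sum//; last by move=> i; apply: (integrableZl mB); exact: iC.
  rewrite big1// => i _; rewrite integralZl ?iC// -integral_mkcondr D0 ?mule0//.
  rewrite -[G]mE; apply: measurableI; rewrite mE//.
have h'K w : 0 <= h' w <= `|K + K|.
  rewrite /h' le_max lexx/= ge_max normr_ge0/= ge_min ler_norm//.
have h'E0 (v : T') : setT v -> (0 <= (EFin \o h') v)%E.
  by move=> _; rewrite lee_fin; have /andP[] := h'K v.
have mh'T : measurable_fun setT h'.
  apply: measurable_maxr => //; apply: measurable_minr => //; exact: measurable_funD.
have h'0 : (\int[P]_(w in B) (h' w * D w)%:E = 0)%E.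
  have [|||||_ _] := @dominated_convergence _ _ _ P B mB
      (fun n w => (phi n w * D w)%:E) (fun w => (h' w * D w)%:E)
      (fun w => (`|K + K| * `|D w|)%:E).
  - by move=> n; apply/measurable_EFinP; apply: measurable_funTS; exact: measurable_funM.
  - by apply/measurable_EFinP; apply: measurable_funTS; exact: measurable_funM.
  - apply: aeW => w Bw; apply: cvg_EFin; first by apply: nearW.
    apply: cvgMl => /=.
    by have := @cvg_nnsfun_approx _ T' R setT measurableT _ mh' h'E0 w I; move/fine_cvgP => [].
  - by exact: (integrableZl mB `|K + K| (integrable_abse iB)).
  - apply: aeW => w n Bw; rewrite lee_fin normrM ler_wpM2r//.
    have := @le_approx _ T' R setT _ n w h'E0 I.
    rewrite -(nnsfun_approxE measurableT mh') lee_fin => h1.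
    rewrite ger0_norm; last by [].
    by rewrite (le_trans h1)//; have /andP[] := h'K w.
  - under eq_fun do rewrite phi0.
    by move=> h1; apply: (cvg_unique _ h1) => //; exact: cvg_cst.
(* The shift by [K] is undone here; [K D] also integrates to zero over [B]. *)
transitivity (\int[P]_(w in B) ((h' w * D w)%:E - (K * D w)%:E))%E.
  apply: ae_eq_integral => //.
  - by apply/measurable_EFinP; apply: measurable_funTS; exact: measurable_funM.
  - apply: emeasurable_funB; apply/measurable_EFinP; apply: measurable_funTS; exact: measurable_funM.
  - apply: filterS hK => w; rewrite ler_norml => /andP[h1 h2] _.
    rewrite -EFinB /h' min_r ?lerD2r// max_r; last by rewrite -lerBlDr sub0r.
    by congr EFin; ring.
rewrite integralB_EFin //.
- by rewrite h'0 sub0e (integralZl mB iB) D0// mule0 oppe0.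
- apply: (@ae_le_integrable _ _ (fun w => `|K + K| * `|D w|)) => //.
  + by apply: measurable_funTS; exact: measurable_funM.
  + by exact: (integrableZl mB `|K + K| (integrable_abse iB)).
  + apply: aeW => w _; rewrite normrM ler_wpM2r// ger0_norm; by have /andP[] := h'K w.
- exact: (integrableZl mB K iB).
Qed.
End sub_sigma_algebra.

(** * Martingale transforms *)

Section martingales.
Context {d : measure_display} {T : measurableType d} {R : realType}
  (P : probability T R) (F : R -> set (set T)) (usualF : usual_conditions P F).
Implicit Types (X Y Z V : process R T) (s t : R) (B : set T).

Lemma usual_sigma_algebra t : 0 <= t -> sigma_algebra setT (F t).
Proof. by case: usualF => -[H _ _] _ _; exact: H. Qed.

Lemma usual_setT t : 0 <= t -> F t setT.
Proof.
move=> t0; have [h0 hC _] := usual_sigma_algebra t0.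
by rewrite -setC0 -setTD; exact: hC.
Qed.

Lemma usual_measurable t : 0 <= t -> F t `<=` measurable.
Proof. by case: usualF => -[_ H _] _ _; exact: H. Qed.

Lemma usual_le s t : 0 <= s -> s <= t -> F s `<=` F t.
Proof. by case: usualF => -[_ _ H] _ _; exact: H. Qed.

Lemma usual_negligible t : 0 <= t -> P.-negligible `<=` F t.
Proof.
move=> t0; apply: (subset_trans (usual_complete usualF)).
exact: usual_le.
Qed.

Lemma adapted_measurable X t : adapted F X -> 0 <= t -> measurable_fun setT (X t).
Proof. by move=> aX t0; apply: (sub_measurable_fun (usual_measurable t0)); exact: aX. Qed.

Lemma adapted_leq X s t : adapted F X -> 0 <= s -> s <= t ->
  g_sigma_algebra_preimage (X s) `<=` F t.
Proof. by move=> aX s0 st; apply: (sub_measurable_leq (usual_le s0 st)); exact: aX. Qed.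

Lemma integrable_increment X s t : martingale P F X -> 0 <= s -> s <= t ->
  P.-integrable setT (EFin \o (X t \- X s)).
Proof.
move=> [_ iX _] s0 st; have t0 := le_trans s0 st.
exact: (integrableB measurableT (iX _ t0) (iX _ s0)).
Qed.

Lemma martingale_increment X s t B : martingale P F X -> 0 <= s -> s <= t -> F s B ->
  (\int[P]_(w in B) (X t w - X s w)%:E = 0)%E.
Proof.
move=> [_ iX EX] s0 st FB; have t0 := le_trans s0 st.
have mB := usual_measurable s0 FB.
have iXB u : 0 <= u -> P.-integrable B (EFin \o X u).
  by move=> u0; apply: integrableS (iX u u0).
under eq_integral do rewrite EFinB.
rewrite integralB_EFin ?iXB//; have [_ _ ->//] := EX s t s0 st.
by rewrite subee// (integrable_fin_num _ (iXB _ t0)).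
Qed.

Lemma martingale_of_increment X : adapted F X ->
  (forall t, 0 <= t -> P.-integrable setT (EFin \o X t)) ->
  (forall s t B, 0 <= s -> s <= t -> F s B ->
    (\int[P]_(w in B) (X t w - X s w)%:E = 0)%E) ->
  martingale P F X.
Proof.
move=> aX iX X0; split=> // s t s0 st; have t0 := le_trans s0 st.
split=> //; [exact: aX|exact: iX|move=> B FB].
have mB := usual_measurable s0 FB.
have iXB u : 0 <= u -> P.-integrable B (EFin \o X u).
  by move=> u0; apply: integrableS (iX u u0).
have := X0 _ _ _ s0 st FB; under eq_integral do rewrite EFinB.
rewrite integralB_EFin ?iXB// => /eqP; rewrite sube_eq ?add0e => [/eqP//||].
  by rewrite (integrable_fin_num _ (iXB _ t0)).
by rewrite fin_num_adde_defl// (integrable_fin_num _ (iXB _ s0)).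
Qed.

(** The weight of a cell is known at its left end, so [integral_bounded_orthogonal] applies cell by
    cell with the sigma-algebra of that time, which contains [B]. *)
Lemma martingale_transform Y V (K : R) s t k :
  martingale P F Y -> adapted F V ->
  (forall u, 0 <= u -> \forall w \ae P, `|V u w| <= K) -> 0 <= s -> s <= t ->
  P.-integrable setT (EFin \o (fun w => riemann_sum (V ^~ w) (Y ^~ w) s t k)) /\
  forall B, F s B ->
    (\int[P]_(w in B) (riemann_sum (V ^~ w) (Y ^~ w) s t k)%:E = 0)%E.
Proof.
move=> mY aV VK s0 st.
have g0 i : 0 <= grid s t k i by rewrite (le_trans s0)// grid_ge.
have gS i : grid s t k i <= grid s t k i.+1 by exact: grid_le.
have H i := integral_bounded_orthogonal (usual_sigma_algebra (g0 i)) (usual_measurable (g0 i))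
   (integrable_increment mY (g0 i) (gS i))
   (fun B => martingale_increment mY (g0 i) (gS i)) (aV _ (g0 i)) (VK _ (g0 i)).
have Hi i := (H i).1.
split=> [|B FB].
  rewrite (_ : _ \o _ = fun w => (\sum_(i < k.+1) (V (grid s t k i) w *
      (Y (grid s t k i.+1) w - Y (grid s t k i) w))%:E)%E).
    by apply: (integrable_sum measurableT) => i _; exact: Hi.
  by apply/funext => w; rewrite /= sumEFin.
have mB := usual_measurable s0 FB.
under eq_integral do rewrite -sumEFin.
rewrite integral_sum//.
  by rewrite big1// => i _; apply: (H i).2; apply: usual_le FB => //; exact: grid_ge.
by move=> i; apply: integrableS (Hi i).
Qed.

(** The increment of [Z] inherits the zero integrals of the transforms by dominated convergence:
    [K'] dominates, and [K] provides integrability of the transforms and of [Z]. *)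
Lemma bounded_martingale_riemann_limit Y V Z (K K' : R) :
  martingale P F Y -> adapted F V -> adapted F Z ->
  (\forall w \ae P, forall t, 0 <= t -> `|V t w| <= K) ->
  (\forall w \ae P, forall t, 0 <= t -> `|Z t w| <= K) ->
  (forall s t, 0 <= s -> s <= t -> \forall w \ae P,
     riemann_sum (V ^~ w) (Y ^~ w) s t k @[k --> \oo] --> Z t w - Z s w) ->
  (forall s t, 0 <= s -> s <= t -> \forall w \ae P,
     forall k, `|riemann_sum (V ^~ w) (Y ^~ w) s t k| <= K') ->
  martingale P F Z.
Proof.
move=> mY aV aZ VK ZK cvgS bndS; apply: martingale_of_increment => //.
  move=> t t0; apply: (@ae_bounded_integrable _ _ _ _ _ K).
    exact: adapted_measurable.
  by apply: filterS ZK => w; apply.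
move=> s t B s0 st FB; have t0 := le_trans s0 st.
have mB := usual_measurable s0 FB.
have VK' u : 0 <= u -> \forall w \ae P, `|V u w| <= K.
  by move=> u0; apply: filterS VK => w; apply.
have tr k := martingale_transform k mY aV VK' s0 st.
have [|||||_ _] := @dominated_convergence _ _ _ P B mB
    (fun k w => (riemann_sum (V ^~ w) (Y ^~ w) s t k)%:E) (fun w => (Z t w - Z s w)%:E)
    (fun w => K'%:E).
- move=> k; apply: measurable_funTS; apply: (measurable_int P); exact: (tr k).1.
- apply/measurable_EFinP; apply: measurable_funTS.
  by apply: measurable_funB; exact: adapted_measurable.
- apply: filterS (cvgS _ _ s0 st) => w Zw _.
  by apply: cvg_EFin; [exact: nearW|].
- exact: finite_measure_integrable_cst.
- by apply: filterS (bndS _ _ s0 st) => w H n _; rewrite lee_fin.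
- under eq_fun do rewrite (tr _).2//.
  by move=> h1; apply: (cvg_unique _ h1) => //; exact: cvg_cst.
Qed.

End martingales.

(** * Uniform integrability and optional stopping *)

Section uniform_integrability.
Context {d : measure_display} {T : measurableType d} {R : realType}
  (P : probability T R).

(** Measures uniform integrability in place of [|x|] restricted to [|x| > K]: it is continuous,
    which suits limits, and convex, which yields the inequality under stopping. *)
Definition excess (K x : R) := Num.max 0 (`|x| - K).

Lemma excess_ge0 K x : 0 <= excess K x.
Proof. by rewrite /excess le_max lexx. Qed.

Lemma excess0 x : excess 0 x = `|x|.
Proof. by rewrite /excess subr0 max_r. Qed.

Lemma continuous_excess K : continuous (excess K).
Proof.
move=> x; apply: (@cvg_comp _ _ _ _ (Num.max (0 : R)) _ (nbhs (`|x| - K))); last first.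
  exact: continuous_max0.
apply: (@cvgB _ R^o); last exact: cvg_cst.
exact: norm_continuous.
Qed.

Lemma measurable_excess K (f : T -> R) : measurable_fun setT f ->
  measurable_fun setT (excess K \o f).
Proof.
move=> mf; apply: measurable_maxr => //; apply: measurable_funB => //.
exact: measurableT_comp.
Qed.

Definition truncate (K x : R) := Num.max (- K) (Num.min K x).

Lemma truncateB K x : 0 <= K -> `|x - truncate K x| = excess K x.
Proof.
rewrite /excess /truncate => K0; have [x0|x0] := leP 0 x.
  rewrite (ger0_norm x0) max_r; last by rewrite le_min; apply/andP; split; lra.
  have [Kx|Kx] := leP K x; first by rewrite ger0_norm ?subr_ge0// max_r// subr_ge0.
  by rewrite subrr normr0 max_l//; lra.
rewrite (ltr0_norm x0) (min_r (_ : x <= K)); last by lra.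
have [Kx|Kx] := leP (- K) x; first by rewrite subrr normr0 max_l//; lra.
by rewrite ltr0_norm ?max_r; lra.
Qed.

Lemma continuous_truncate K : continuous (truncate K).
Proof.
move=> x; rewrite /truncate.
apply: (@continuous_max _ _ (cst (- K)) (fun x => Num.min K x)); first exact: cst_continuous.
by apply: (@continuous_min _ _ (cst K) id); [exact: cst_continuous|exact: cvg_id].
Qed.

Lemma truncate_bounded K x : 0 <= K -> `|truncate K x| <= K.
Proof.
move=> K0; rewrite ler_norml /truncate le_max lexx/= ge_max ge_min lexx/= andbT.
lra.
Qed.

Lemma measurable_truncate K (f : T -> R) : measurable_fun setT f ->
  measurable_fun setT (truncate K \o f).
Proof. by move=> mf; apply: measurable_maxr => //; apply: measurable_minr. Qed.

Lemma fatou_le (f_ : (T -> R)^nat) (f : T -> R) (e : R) :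
  (forall n, measurable_fun setT (f_ n)) -> measurable_fun setT f ->
  (forall n w, 0 <= f_ n w) -> (forall w, 0 <= f w) ->
  (\forall w \ae P, f_ n w @[n --> \oo] --> f w) ->
  (forall n, (\int[P]_w (f_ n w)%:E <= e%:E)%E) ->
  (\int[P]_w (f w)%:E <= e%:E)%E.
Proof.
move=> mf_ mf f_0 f0 ff fe.
have mE n : measurable_fun setT (EFin \o f_ n) by exact/measurable_EFinP.
rewrite (ae_eq_integral (fun w => limn_einf (fun n => (f_ n w)%:E)))//.
- have := @fatou _ _ _ P setT measurableT (fun n => EFin \o f_ n) mE _.
  have H0 n w : setT w -> (0 <= (EFin \o f_ n) w)%E by rewrite lee_fin.
  move=> /(_ H0) /le_trans; apply.
  rewrite limn_einf_lim; apply: lime_le; first exact: is_cvg_einfs.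
  apply: nearW => n; apply: le_trans (fe n).
  by apply: ereal_inf_lbound; exists n => //; exact: leqnn.
- exact/measurable_EFinP.
- rewrite /limn_einf; apply: measurableT_comp => //.
  apply: (measurable_fun_limn_esup (f := fun n w => (- (f_ n w)%:E)%E)) => n.
  by apply: measurableT_comp => //; exact: mE.
- apply: filterS ff => w fw _.
  have /cvg_limn_einf_sup[->//] : (f_ n w)%:E @[n --> \oo] --> (f w)%:E.
  by apply: cvg_EFin => //; exact: nearW.
Qed.

Lemma integrable_of_norm_le (f : T -> R) (e : R) : measurable_fun setT f ->
  (\int[P]_w (`|f w|)%:E <= e%:E)%E -> P.-integrable setT (EFin \o f).
Proof.
move=> mf fe; apply/integrableP; split; first exact/measurable_EFinP.
by apply: le_lt_trans fe _; exact: ltry.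
Qed.

Lemma norm_Rintegral_le (f : T -> R) B (e : R) : measurable B -> measurable_fun setT f ->
  (\int[P]_w (`|f w|)%:E <= e%:E)%E -> `|\int[P]_(w in B) f w| <= e.
Proof.
move=> mB mf fe; have ifT := integrable_of_norm_le mf fe.
have ifB : P.-integrable B (EFin \o f) by apply: integrableS ifT.
rewrite -lee_fin EFin_normr_Rintegral//.
apply: le_trans (le_abse_integral _ mB _) _; first exact: (measurable_int P).
apply: le_trans fe; apply: ge0_subset_integral => //.
by do 2 apply: measurableT_comp => //.
Qed.

(** Vitali's theorem. Truncations at [m] converge in mean by bounded convergence, and each
    truncation error is at most [e m], for [W] by Fatou; so the limit differs from [a] by at most
    [2 e m]. Level [0], where the excess is the absolute value, gives integrability. *)
Lemma uniformly_integrable_limit (W_ : (T -> R)^nat) (W : T -> R) (e : R^nat) B (a : R) :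
  (forall n, measurable_fun setT (W_ n)) -> measurable_fun setT W ->
  (\forall w \ae P, W_ n w @[n --> \oo] --> W w) ->
  (forall m n, (\int[P]_w (excess m%:R (W_ n w))%:E <= (e m)%:E)%E) ->
  e m @[m --> \oo] --> (0 : R) ->
  measurable B -> (forall n, \int[P]_(w in B) W_ n w = a) ->
  P.-integrable setT (EFin \o W) /\ \int[P]_(w in B) W w = a.
Proof.
move=> mW_ mW WW We e0 mB Wa.
have We' m : (\int[P]_w (excess m%:R (W w))%:E <= (e m)%:E)%E.
  apply: (@fatou_le (fun n => excess m%:R \o W_ n)) => //.
  - by move=> n; exact: measurable_excess.
  - exact: measurable_excess.
  - by move=> n w; exact: excess_ge0.
  - by move=> w; exact: excess_ge0.
  - apply: filterS WW => w cw.
    exact: (continuous_cvg _ (@continuous_excess _ _) cw).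
  - exact: We.
have intW : forall (V : T -> R) (m : nat), measurable_fun setT V ->
   (\int[P]_w (excess m%:R (V w))%:E <= (e m)%:E)%E ->
   (\int[P]_w (`|V w - truncate m%:R (V w)|)%:E <= (e m)%:E)%E.
  by move=> V m mV; under [X in _ -> (X <= _)%E]eq_integral do rewrite truncateB//.
have iW_ n : P.-integrable setT (EFin \o W_ n).
  apply: (@integrable_of_norm_le _ (e 0%N)) => //.
  by have := We 0%N n; under eq_integral do rewrite excess0.
have iW : P.-integrable setT (EFin \o W).
  apply: (@integrable_of_norm_le _ (e 0%N)) => //.
  by have := We' 0%N; under eq_integral do rewrite excess0.
split=> //.
have iT : forall (V : T -> R) (m : nat), measurable_fun setT V ->
    P.-integrable setT (EFin \o (truncate m%:R \o V)).
  move=> V m mV; apply: (@ae_bounded_integrable _ _ _ _ _ m%:R).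
    exact: measurable_truncate.
  by apply: aeW => w; exact: truncate_bounded.
have iTW m : P.-integrable B (EFin \o (truncate m%:R \o W)).
  by apply: integrableS (iT W m mW).
have cT m : \int[P]_(w in B) truncate m%:R (W_ n w) @[n --> \oo] -->
            \int[P]_(w in B) truncate m%:R (W w).
  have [|||||_ _ H] := @dominated_convergence _ _ _ P B mB
    (fun n w => (truncate m%:R (W_ n w))%:E) (fun w => (truncate m%:R (W w))%:E)
    (fun w => m%:R%:E).
  - by move=> n; apply: measurable_funTS; apply: measurableT_comp => //; exact: measurable_truncate.
  - by apply: measurable_funTS; apply: measurableT_comp => //; exact: measurable_truncate.
  - apply: filterS WW => w cw _; apply: cvg_EFin; first exact: nearW.
    exact: (continuous_cvg _ (@continuous_truncate _ _) cw).
  - exact: finite_measure_integrable_cst.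
  - by apply: aeW => w n _; rewrite lee_fin truncate_bounded.
  apply: fine_cvg; rewrite fineK//.
  exact: integrable_fin_num (iTW m).
have tail : forall (V : T -> R) (m : nat), measurable_fun setT V ->
    P.-integrable setT (EFin \o V) ->
    (\int[P]_w (excess m%:R (V w))%:E <= (e m)%:E)%E ->
    `|\int[P]_(w in B) V w - \int[P]_(w in B) truncate m%:R (V w)| <= e m.
  move=> V m mV iV Ve; rewrite -RintegralB//.
  - apply: norm_Rintegral_le => //; last exact: intW.
    by apply: measurable_funB => //; exact: measurable_truncate.
  - by apply: integrableS iV.
  - by apply: integrableS (iT V m mV).
have H m : `|\int[P]_(w in B) W w - a| <= e m + e m.
  have cR : (e m + e m) + `|\int[P]_(w in B) truncate m%:R (W w) -
      \int[P]_(w in B) truncate m%:R (W_ n w)| @[n --> \oo] --> e m + e m.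
    rewrite -[X in _ --> X]addr0; apply: (@cvgD _ R^o); first exact: cvg_cst.
    rewrite -(normr0 R) -(subrr (\int[P]_(w in B) truncate m%:R (W w))).
    by apply: cvg_norm; apply: (@cvgB _ R^o) => //; exact: cvg_cst.
  have ca : `|\int[P]_(w in B) W w - a| @[n --> \oo] --> `|\int[P]_(w in B) W w - a|.
    exact: cvg_cst.
  apply: (ler_cvg_to ca cR); apply: nearW => n.
  have := tail _ m mW iW (We' m); have := tail _ m (mW_ n) (iW_ n) (We m n).
  rewrite Wa; move: (Rintegral _ _ _) (Rintegral _ _ _) (Rintegral _ _ _) => v z u.
  move=> h1 h2.
  have -> : z - a = (z - v) - (a - u) + (v - u) by ring.
  rewrite (le_trans (ler_normD _ _))// lerD2r (le_trans (ler_normB _ _))// lerD//.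
apply/eqP; rewrite -subr_eq0 -normr_le0.
have ce : e m + e m @[m --> \oo] --> (0 : R).
  by rewrite -(addr0 0); exact: (@cvgD _ R^o).
have ca : `|\int[P]_(w in B) W w - a| @[m --> \oo] --> `|\int[P]_(w in B) W w - a|.
  exact: cvg_cst.
by apply: (ler_cvg_to ca ce); apply: nearW => m; exact: H.
Qed.

End uniform_integrability.

(** * Stopped paths as limits of transforms on a grid *)

Section stopped_paths.
Context {R : realType}.
Implicit Types (y : R -> R) (s t : R) (r : \bar R).

Definition stop t r : R := fine (mine t%:E r).

Lemma EFin_stop t r : (0 <= r)%E -> (stop t r)%:E = mine t%:E r.
Proof.
rewrite /stop; case: r => [r||//] _; last by rewrite miney.
by rewrite -EFin_min.
Qed.

Lemma stop_ge0 t r : 0 <= t -> (0 <= r)%E -> 0 <= stop t r.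
Proof. by move=> t0 r0; rewrite -lee_fin EFin_stop// le_min lee_fin t0. Qed.

Lemma stop_le t r : 0 <= t -> (0 <= r)%E -> stop t r <= t.
Proof. by move=> t0 r0; rewrite -lee_fin EFin_stop// ge_min lexx. Qed.

Lemma stop_id t r : 0 <= t -> (t%:E <= r)%E -> stop t r = t.
Proof. by move=> t0 tr; rewrite /stop min_l. Qed.

Lemma stop_homo s t r : 0 <= s -> s <= t -> (0 <= r)%E -> stop s r <= stop t r.
Proof.
move=> s0 st r0; rewrite -lee_fin !EFin_stop//.
by rewrite le_min !ge_min lexx orbT lee_fin st.
Qed.

Lemma stop_stop t r1 r2 : (0 <= r1)%E -> (0 <= r2)%E ->
  stop (stop t r1) r2 = stop t (mine r1 r2).
Proof. by move=> r10 r20; apply: EFin_inj; rewrite !EFin_stop ?le_min ?r10// minA. Qed.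

(** Both sides vanish when [r < s]. The right-hand side is the form produced by sums over [[s, t]]
    weighted by [before r]. *)
Lemma stopped_increment y s t r : 0 <= s -> s <= t -> (0 <= r)%E ->
  y (stop t r) - y (stop s r) = y (Num.max s (stop t r)) - y s.
Proof.
move=> s0 st r0; have t0 := le_trans s0 st; have [sr|rs] := leP s%:E r.
  rewrite (stop_id s0 sr) max_r// -lee_fin EFin_stop//.
  by rewrite le_min lee_fin st.
have -> : stop t r = stop s r.
  apply: EFin_inj; rewrite !EFin_stop// (min_r (ltW rs)) min_r//.
  by rewrite (le_trans (ltW rs))// lee_fin.
by rewrite max_l ?subrr// stop_le.
Qed.

Lemma continuous_stop y r : (0 <= r)%E -> continuous (y \o Num.max 0) ->
  continuous ((fun u => y (stop u r)) \o Num.max 0).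
Proof.
move=> r0 cy u.
have st u' : stop (Num.max 0 u') r = Num.max 0 (stop (Num.max 0 u') r).
  by apply/esym/max_r/stop_ge0 => //; rewrite le_max lexx.
rewrite (_ : _ \o _ = (y \o Num.max 0) \o (fun u => stop (Num.max 0 u) r)); last first.
  by apply/funext => u'; rewrite /= -st.
apply: (@cvg_comp _ _ _ _ (y \o Num.max 0) _ (nbhs (stop (Num.max 0 u) r))); last exact: cy.
case: r r0 {st} => [r||//] r0.
  rewrite (_ : (fun u => _) = (fun u => Num.min (Num.max 0 u) r)).
    rewrite (_ : stop _ _ = Num.min (Num.max 0 u) r).
      exact: (@continuous_min R R (Num.max 0) (cst r) u (@continuous_max0 R u) (@cst_continuous _ _ r u)).
    by rewrite /stop -EFin_min.
  by apply/funext => u'; rewrite /stop -EFin_min.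
have sy u' : stop (Num.max 0 u') +oo%E = Num.max 0 u' by rewrite /stop miney.
by under eq_fun do rewrite sy; rewrite sy; exact: continuous_max0.
Qed.

(** The inequality is strict because [u < tau] is the complement of [tau <= u], hence known at time
    [u]. *)
Definition before r (u : R) : R := (u%:E < r)%E%:R.

(** [j] is the first index whose grid point is not before [r], or [k + 1] if there is none. The grid
    point [j] overshoots the stopped time by at most one cell. *)
Lemma exit_index s t r k : s <= t -> (0 <= r)%E -> 0 <= s ->
  exists j, [/\ (j <= k.+1)%N,
    (forall i, (i < k.+1)%N -> before r (grid s t k i) = (i < j)%:R) &
    `|Num.max s (stop t r) - grid s t k j| <= (t - s) / k.+1%:R].
Proof.
move=> st r0 s0; have t0 := le_trans s0 st.
have exj : exists i, (i == k.+1) || ~~ ((grid s t k i)%:E < r)%E.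
  by exists k.+1; rewrite eqxx.
case: (ex_minnP exj) => j jP jmin.
have jk : (j <= k.+1)%N by rewrite jmin// eqxx.
exists j; split=> // [i ik|].
  rewrite /before; congr (nat_of_bool _)%:R.
  have [ij|ji] := ltnP i j.
    apply/negPn/negP => ni; have := jmin i; rewrite ni orbT => /(_ isT).
    by rewrite leqNgt ij.
  apply/negP => ri; have jk' := leq_ltn_trans ji ik.
  move: jP; rewrite (ltn_eqF jk')/= => /negP; apply.
  by apply: le_lt_trans ri; rewrite lee_fin grid_le.
have cj : Num.max s (stop t r) <= grid s t k j.
  rewrite ge_max grid_ge//=; case/orP: jP => [/eqP ->|]; first by rewrite gridS stop_le.
  rewrite -leNgt => rj; rewrite -lee_fin EFin_stop//.
  by rewrite ge_min rj orbT.
have step0 : 0 <= (t - s) / k.+1%:R by rewrite divr_ge0// subr_ge0.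
rewrite ler0_norm ?subr_le0// opprB.
case: j => [|j] in jP jmin jk cj *.
  by rewrite grid0 lerBlDl (le_trans _ (_ : Num.max s (stop t r) <= _))// ?lerDl// le_max lexx.
rewrite -(grid_step s t k j) lerB// le_max; apply/orP; right.
have jr : ((grid s t k j)%:E < r)%E.
  by apply/negPn/negP => nj; have := jmin j; rewrite nj orbT ltnn => /(_ isT).
rewrite -lee_fin EFin_stop// le_min (ltW jr) andbT lee_fin grid_leT//.
exact: ltnW.
Qed.

Lemma riemann_sum_before y s t r k j : (j <= k.+1)%N ->
  (forall i, (i < k.+1)%N -> before r (grid s t k i) = (i < j)%:R) ->
  riemann_sum (before r) y s t k = y (grid s t k j) - y s.
Proof.
move=> jk H; rewrite /riemann_sum.
rewrite -(big_mkord xpredT (fun i => before r (grid s t k i) *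
  (y (grid s t k i.+1) - y (grid s t k i)))).
rewrite (big_cat_nat _ jk)//= [X in _ + X]big_nat_cond [X in _ + X]big1 ?addr0.
  rewrite big_nat_cond (eq_bigr (fun i => y (grid s t k i.+1) - y (grid s t k i))).
    by rewrite -big_nat_cond telescope_sumr// grid0.
  by move=> i /andP[/andP[_ ij] _]; rewrite H ?ij ?mul1r// (leq_trans ij).
by move=> i /andP[/andP[ji ik] _]; rewrite H// ltnNge ji mul0r.
Qed.

Lemma riemann_sum_before_cvg y s t r : continuous (y \o Num.max 0) ->
  s <= t -> (0 <= r)%E -> 0 <= s ->
  riemann_sum (before r) y s t k @[k --> \oo] --> y (Num.max s (stop t r)) - y s.
Proof.
move=> cy st r0 s0; apply/(@cvgrPdist_lt _ R^o) => e e0.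
have t0 := le_trans s0 st.
apply: filterS (uniform_mesh s t (t - s) cy e0) => k H.
have [j [jk jb jd]] := exit_index k st r0 s0.
rewrite (riemann_sum_before y jk jb).
have := H (Num.max s (stop t r)) (grid s t k j).
rewrite le_max lexx/= ge_max st stop_le//= => /(_ isT jd).
have c0 : 0 <= Num.max s (stop t r) by rewrite le_max s0.
have g0 : 0 <= grid s t k j by rewrite (le_trans s0)// grid_ge.
by rewrite /= (max_r c0) (max_r g0) opprB addrA subrK.
Qed.

Lemma riemann_sum_before_cvgD y s t r : continuous (y \o Num.max 0) ->
  s <= t -> (0 <= r)%E -> 0 <= s ->
  y s + riemann_sum (before r) y s t k @[k --> \oo] --> y (Num.max s (stop t r)).
Proof.
move=> cy st r0 s0; rewrite -[y (Num.max _ _)](subrKC (y s)).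
apply: (@cvgD _ R^o); first exact: cvg_cst.
exact: riemann_sum_before_cvg.
Qed.

(* A subgradient of the convex function [excess m]. *)
Definition excess_slope (m x : R) : R :=
  \1_(`]m, +oo[%classic) x - \1_(`]-oo, (- m)[%classic) x.

Lemma excess_slopeE m x : excess_slope m x = (m < x)%R%:R - (x < - m)%R%:R.
Proof. by rewrite /excess_slope !indicE !mem_setE !in_itv/= andbT. Qed.

Lemma excess_slopeP m (x z : R) : 0 <= m ->
  excess_slope m x * (z - x) <= excess m z - excess m x.
Proof.
move=> m0; rewrite excess_slopeE /excess.
have z1 := ler_norm z; have z2 : - z <= `|z| by rewrite -normrN ler_norm.
have h1 : `|z| - m <= Num.max 0 (`|z| - m) by rewrite le_max lexx orbT.
have h2 : 0 <= Num.max 0 (`|z| - m) by rewrite le_max lexx.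
move: (Num.max 0 (`|z| - m)) h1 h2 => ez h1 h2.
have [mx|mx] := ltP m x; have [xm|xm] := ltP x (- m);
  rewrite /= ?mulr1n ?mulr0n ?subr0 ?sub0r ?subrr ?mulN1r ?mul1r ?mul0r.
- lra.
- by rewrite (gtr0_norm (le_lt_trans m0 mx)) max_r; lra.
- by rewrite ltr0_norm ?max_r; lra.
- rewrite max_l; first by lra.
  by rewrite subr_le0 ler_norml xm.
Qed.

Lemma excess_slope_norm m x : 0 <= m -> `|excess_slope m x| <= 1.
Proof.
move=> m0; rewrite excess_slopeE ler_norml.
by case: ltP => ?; case: ltP => ?;
  rewrite /= ?mulr1n ?mulr0n ?subrr ?subr0 ?sub0r; lra.
Qed.

(** On the left [y] is evaluated at the grid point of the exit index; the subgradient inequalities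
    over the later cells telescope from there to [t]. The subtracted sum is again a transform, of
    mean zero. *)
Lemma excess_riemann_sum_before y s t r k m : 0 <= m ->
  s <= t -> (0 <= r)%E -> 0 <= s ->
  excess m (y s + riemann_sum (before r) y s t k) <=
  excess m (y t) - riemann_sum (fun u => (1 - before r u) * excess_slope m (y u)) y s t k.
Proof.
move=> m0 st r0 s0.
have [j [jk jb _]] := exit_index k st r0 s0.
rewrite (riemann_sum_before y jk jb) subrKC lerBrDr -lerBrDl.
rewrite -[X in excess m (y X) - _](gridS s t k).
rewrite -(telescope_sumr (fun i => excess m (y (grid s t k i))) jk).
rewrite /riemann_sum -(big_mkord xpredT (fun i => (1 - before r (grid s t k i)) *
   excess_slope m (y (grid s t k i)) * (y (grid s t k i.+1) - y (grid s t k i)))).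
rewrite (big_cat_nat _ jk)//= [X in X + _]big_nat_cond [X in X + _]big1 ?add0r.
  rewrite big_nat_cond [leRHS]big_nat_cond.
  apply: ler_sum => i /andP[/andP[ji ik] _].
  by rewrite jb// ltnNge ji subr0 mul1r excess_slopeP.
by move=> i /andP[/andP[_ ij] _]; rewrite jb ?ij ?subrr ?mul0r// (leq_trans ij).
Qed.

End stopped_paths.

Section optional_stopping.
Context {d : measure_display} {T : measurableType d} {R : realType}
  (P : probability T R) (F : R -> set (set T)) (usualF : usual_conditions P F).
Implicit Types (X Y Z V : process R T) (s t : R) (B : set T) (tau : T -> \bar R).

Lemma continuous_processP X :
  continuous_process P X <-> \forall w \ae P, continuous ((X ^~ w) \o Num.max 0).
Proof. by split; apply: filterS => w /continuous_within_nonneg. Qed.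

Lemma adapted_before tau : stopping_time F tau -> adapted F (fun u w => before (tau w) u).
Proof.
move=> [_ Ft] u u0; apply/(sub_measurableP _ (usual_sigma_algebra usualF u0)).
rewrite (_ : (fun w => _) = \1_(~` [set w | (tau w <= u%:E)%E])).
  apply: measurable_indic; apply: measurableC.
  by rewrite measurable_g_measurableTypeE; [exact: Ft|exact: (usual_sigma_algebra usualF u0)].
apply/funext => w; rewrite /before indicE in_setC; congr (nat_of_bool _)%:R.
by rewrite ltNge; congr negb; apply/idP/idP => [|/set_mem//]; exact: mem_set.
Qed.

Lemma adapted_excess_slope m Y : adapted F Y ->
  adapted F (fun u w => excess_slope m (Y u w)).
Proof.
move=> aY u u0; have sF := usual_sigma_algebra usualF u0.
apply/(sub_measurableP _ sF).
apply: (@measurableT_comp _ _ _ _ _ _ (excess_slope m)); last first.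
  by apply/(sub_measurableP _ sF); exact: aY.
by apply: measurable_funB; exact: measurable_indic.
Qed.

Lemma adapted_riemann_sum Y V s t k : adapted F Y -> adapted F V ->
  0 <= s -> s <= t ->
  g_sigma_algebra_preimage (fun w => riemann_sum (V ^~ w) (Y ^~ w) s t k) `<=` F t.
Proof.
move=> aY aV s0 st; have t0 := le_trans s0 st.
have sF := usual_sigma_algebra usualF t0.
have mg X i : adapted F X -> (i <= k.+1)%N ->
    measurable_fun setT (X (grid s t k i) : g_sigma_algebraType (F t) -> R).
  move=> aX ik; apply/(sub_measurableP _ sF); apply: (adapted_leq usualF) => //.
    by rewrite (le_trans s0)// grid_ge.
  exact: grid_leT.
apply/(sub_measurableP _ sF); rewrite /riemann_sum.
apply: measurable_sum => i; apply: measurable_funM; first by apply: mg => //; exact: ltnW.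
by apply: measurable_funB; apply: mg => //; exact: ltnW.
Qed.

Lemma sub_measurableD t (f g : T -> R) : 0 <= t ->
  g_sigma_algebra_preimage f `<=` F t -> g_sigma_algebra_preimage g `<=` F t ->
  g_sigma_algebra_preimage (f \+ g) `<=` F t.
Proof.
move=> t0; have sF := usual_sigma_algebra usualF t0.
move=> /(sub_measurableP _ sF) mf /(sub_measurableP _ sF) mg.
by apply/(sub_measurableP _ sF); exact: measurable_funD.
Qed.

(** The value at the random time is an almost sure limit of transforms, so joint measurability of
    [X] in time and [w] never enters. *)
Lemma measurable_stop_max X tau s t : adapted F X -> continuous_process P X ->
  stopping_time F tau -> 0 <= s -> s <= t ->
  g_sigma_algebra_preimage (fun w => X (Num.max s (stop t (tau w))) w) `<=` F t.
Proof.
move=> aX /continuous_processP cX st_tau s0 st; have t0 := le_trans s0 st.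
have [tau0 _] := st_tau.
apply: (@sub_ae_cvg _ _ _ P _ (usual_sigma_algebra usualF t0) (usual_negligible usualF t0)
  (fun k w => X s w + riemann_sum (before (tau w)) (X ^~ w) s t k)).
  move=> k; apply: sub_measurableD => //; first exact: (adapted_leq usualF).
  exact: (@adapted_riemann_sum X (fun u w => before (tau w) u)) (adapted_before _) _ _.
apply: filterS cX => w cw.
exact: (riemann_sum_before_cvgD cw).
Qed.

Lemma stopped_adapted X tau : adapted F X -> continuous_process P X ->
  stopping_time F tau -> adapted F (stopped X tau).
Proof.
move=> aX cX st_tau t t0; have [tau0 _] := st_tau.
have := measurable_stop_max aX cX st_tau (lexx 0) t0.
rewrite (_ : (fun w => _) = stopped X tau t)//.
by apply/funext => w; rewrite (max_r (stop_ge0 t0 (tau0 w))).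
Qed.

Lemma stopped_continuous X tau : (forall w, 0 <= tau w)%E ->
  continuous_process P X -> continuous_process P (stopped X tau).
Proof.
move=> tau0 /continuous_processP cX; apply/continuous_processP.
by apply: filterS cX => w cw; exact: (continuous_stop (tau0 w) cw).
Qed.

(* Stopping on the grid is the transform by the indicator of {t_i < tau}.  The
   stopped values [W_ k] are uniformly integrable because the subgradient
   inequality summed over the cells after tau gives
   E[excess m (W_ k)] <= E[excess m (Y t)]. *)
Theorem stopped_martingale Y tau : martingale P F Y -> continuous_process P Y ->
  stopping_time F tau -> martingale P F (stopped Y tau).
Proof.
move=> mY cY st_tau; have [aY iY _] := mY.
have [tau0 _] := st_tau.
pose V u w := before (tau w) u.
have aV : adapted F V := adapted_before st_tau.
have V1 u w : `|V u w| <= 1 by rewrite /V /before; case: (_ < _)%E; rewrite ?normr1 ?normr0.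
(* The maximum with [s] makes the value a limit of [Y s] plus transforms started at [s];
   [stopped_increment] converts the result to the stopped process. *)
have key s t B : 0 <= s -> s <= t -> F s B ->
    P.-integrable setT (EFin \o (fun w => Y (Num.max s (stop t (tau w))) w)) /\
    \int[P]_(w in B) Y (Num.max s (stop t (tau w))) w = \int[P]_(w in B) Y s w.
  move=> s0 st FB; have t0 := le_trans s0 st.
  have mB := usual_measurable usualF s0 FB.
  pose W_ k w := Y s w + riemann_sum (V ^~ w) (Y ^~ w) s t k.
  have aV1 u : 0 <= u -> \forall w \ae P, `|V u w| <= 1 by move=> _; exact: aeW.
  have tr k := martingale_transform usualF k mY aV aV1 s0 st.
  have mW_ k : measurable_fun setT (W_ k).
    apply: measurable_funD; first exact: (adapted_measurable usualF).
    exact/measurable_EFinP/(measurable_int P)/(tr k).1.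
  (* This bound involves [Y t] only, so it is uniform in the grid. *)
  pose e m := fine (\int[P]_w (excess m%:R (Y t w))%:E)%E.
  have mE m : measurable_fun setT (excess m%:R \o Y t).
    by apply: measurable_excess; exact: (adapted_measurable usualF).
  have excess_le m w : `|excess m%:R (Y t w)| <= `|Y t w|.
    by rewrite ger0_norm ?excess_ge0// /excess ge_max normr_ge0/= gerBl.
  have iE m : P.-integrable setT (EFin \o (excess m%:R \o Y t)).
    apply: (@ae_le_integrable _ _ _ _ _ _ (fun w => `|Y t w|)) => //.
      exact: integrable_abse (iY _ t0).
    by apply: aeW => w _; exact: excess_le.
  apply: (@uniformly_integrable_limit _ _ _ P W_ _ e) => //.
  - apply: (sub_measurable_fun (usual_measurable usualF t0)).
    exact: measurable_stop_max.
  - move/continuous_processP : cY; apply: filterS => w cw.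
    exact: (riemann_sum_before_cvgD cw).
  - move=> m k; rewrite /e fineK; last exact: integrable_fin_num (iE m).
    pose U u w := (1 - V u w) * excess_slope m%:R (Y u w).
    have aU : adapted F U.
      move=> u u0; have sF := usual_sigma_algebra usualF u0.
      apply/(sub_measurableP _ sF); apply: measurable_funM.
        by apply: measurable_funB => //; apply/(sub_measurableP _ sF); exact: aV.
      by apply/(sub_measurableP _ sF); exact: adapted_excess_slope.
    have U1 u : 0 <= u -> \forall w \ae P, `|U u w| <= 1.
      move=> _; apply: aeW => w; rewrite /U normrM mulr_ile1// ?excess_slope_norm//.
      by rewrite /V /before; case: (_ < _)%E; rewrite ?subrr ?subr0 ?normr1 ?normr0.
    have [iU U0] := martingale_transform usualF k mY aU U1 s0 st.
    rewrite -[leRHS]sube0 -(U0 _ (usual_setT usualF s0)) -integralB_EFin//; last exact: iE.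
    apply: ge0_le_integral => //.
    + by move=> w _; rewrite lee_fin excess_ge0.
    + by apply/measurable_EFinP; apply: measurable_excess; exact: mW_.
    + apply: emeasurable_funB;  first by apply/measurable_EFinP; exact: mE.
      exact: (measurable_int P).
    + by move=> w _; rewrite -EFinB lee_fin excess_riemann_sum_before.
  - have [|||||_ _ H] := @dominated_convergence _ _ _ P setT measurableT
      (fun m => EFin \o (excess m%:R \o Y t)) (cst 0%E) (EFin \o (fun w => `|Y t w|)).
    + by move=> m; exact/measurable_EFinP.
    + exact: measurable_cst.
    + apply: aeW => w _; apply: cvg_near_cst.
      have [M _ HM] := nbhs_infty_ger `|Y t w|.
      exists M => // m Mm /=; rewrite /excess max_l// subr_le0; exact: HM.
    + exact: integrable_abse (iY _ t0).
    + by apply: aeW => w m _; rewrite lee_fin excess_le.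
    by apply: fine_cvg; move: H; rewrite integral0.
  - move=> k; rewrite RintegralD//.
    + by rewrite [X in _ + X]/Rintegral (tr k).2//= addr0.
    + by apply: integrableS (iY _ s0).
    + by apply: integrableS (tr k).1.
apply: martingale_of_increment => //.
- exact: stopped_adapted.
- move=> t t0.
  have [iW _] := key 0 t setT (lexx 0) t0 (usual_setT usualF (lexx 0)).
  rewrite (_ : stopped Y tau t = fun w => Y (Num.max 0 (stop t (tau w))) w)//.
  by apply/funext => w; rewrite (max_r (stop_ge0 t0 (tau0 w))).
- move=> s t B s0 st FB; have t0 := le_trans s0 st.
  have mB := usual_measurable usualF s0 FB.
  have [iW WE] := key s t B s0 st FB.
  under eq_integral do rewrite (stopped_increment (Y ^~ _) s0 st (tau0 _)) EFinB.
  have iWB : P.-integrable B (EFin \o (fun w => Y (Num.max s (stop t (tau w))) w)).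
    by apply: integrableS iW.
  have iYB : P.-integrable B (EFin \o Y s) by apply: integrableS (iY _ s0).
  rewrite integralB_EFin//.
  move: WE; rewrite /Rintegral => WE.
  rewrite -[X in (X - _)%E]fineK; last exact: integrable_fin_num iWB.
  rewrite WE fineK; last exact: integrable_fin_num iYB.
  by rewrite subee// (integrable_fin_num _ iYB).
Qed.
End optional_stopping.

(** * Hitting times and localization *)

Section hitting_paths.
Context {R : realType}.
Implicit Types (u : R -> R) (s t c : R).

Definition hitting u c : \bar R :=
  ereal_inf [set v%:E | v in [set v | 0 <= v /\ c <= u v]].

Lemma hitting_ge0 u c : (0 <= hitting u c)%E.
Proof. by apply: le_ereal_inf_tmp => _ [v [v0 _] <-]; rewrite lee_fin. Qed.

Lemma hitting_le u c v : 0 <= v -> c <= u v -> (hitting u c <= v%:E)%E.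
Proof. by move=> v0 cv; apply: ereal_inf_lbound; exists v. Qed.

Lemma hitting_homo u c c' : c <= c' -> (hitting u c <= hitting u c')%E.
Proof.
move=> cc; apply: ereal_inf_le_tmp => _ [v [v0 cv] <-]; exists v => //.
by split => //; exact: le_trans cv.
Qed.

Lemma lt_hitting u c s : 0 <= s -> (s%:E < hitting u c)%E -> u s < c.
Proof. by move=> s0; apply: contraTT; rewrite -!leNgt; exact: hitting_le. Qed.

Section continuous.
Variable u : R -> R.
Hypothesis cu : continuous (u \o Num.max 0).

(** If [u < c] on [[0, t]], continuity at [t] keeps [u] below [c] slightly beyond [t], which pushes
    the infimum strictly past [t]. *)
Lemma hitting_leP c t : 0 <= t ->
  (hitting u c <= t%:E)%E <-> exists2 s, 0 <= s <= t & c <= u s.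
Proof.
move=> t0; split=> [|[s /andP[s0 st] cs]]; last first.
  by apply: le_trans (hitting_le s0 cs) _; rewrite lee_fin.
move=> ht; apply: contrapT => nex.
have H s : 0 <= s <= t -> u s < c.
  by move=> st; rewrite ltNge; apply/negP => cs; apply: nex; exists s.
have tc : 0 < c - u t by rewrite subr_gt0 H// t0 lexx.
have /(@cvgrPdist_lt _ R^o) /(_ _ tc) := @cu t.
move=> /nbhs_ballP[r /= r0 Hr].
suff : ((t + r)%:E <= hitting u c)%E.
  by move/le_trans => /(_ _ ht); rewrite lee_fin; lra.
apply: le_ereal_inf_tmp => _ [v [v0 cv] <-]; rewrite lee_fin leNgt; apply/negP => vtr.
have [vt|tv] := leP v t; first by have := H v; rewrite v0 vt => /(_ isT); lra.
have := Hr v; rewrite -ball_normE /= (max_r t0) (max_r v0).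
rewrite ltr_norml => /(_ _)/wrap[]; first by apply/andP; split; lra.
by rewrite ltr_norml; lra.
Qed.

(** A value above [c] at a positive time would persist slightly to the left, before the hitting
    time. At time [0] there is no left side, whence [u 0]. *)
Lemma stop_hitting_le c t : 0 <= t -> u (stop t (hitting u c)) <= Num.max c (u 0).
Proof.
move=> t0; have h0 := hitting_ge0 u c.
have := stop_ge0 t0 h0.
have : ((stop t (hitting u c))%:E <= hitting u c)%E by rewrite EFin_stop// ge_min lexx orbT.
move: (stop _ _) => q qh; rewrite le_eqVlt => /predU1P[<-|q0].
  by rewrite le_max lexx orbT.
rewrite le_max; apply/orP; left; rewrite leNgt; apply/negP => cq.
have tc : 0 < u q - c by rewrite subr_gt0.
have /(@cvgrPdist_lt _ R^o) /(_ _ tc) := @cu q.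
move=> /nbhs_ballP[r /= r0 Hr].
(* A time strictly before [q], nonnegative and within [r] of [q]. *)
pose s := Num.max (q / 2) (q - r / 2).
have sq : s < q by rewrite /s gt_max; apply/andP; split; lra.
have s1 : q / 2 <= s by rewrite /s le_max lexx.
have s2 : q - r / 2 <= s by rewrite /s le_max lexx orbT.
have s0 : 0 <= s by lra.
have us : u s < c.
  by apply: lt_hitting => //; apply: lt_le_trans qh; rewrite lte_fin.
have := Hr s; rewrite -ball_normE /= (max_r (ltW q0)) (max_r s0).
rewrite ltr_norml => /(_ _)/wrap[]; first by apply/andP; split; lra.
by rewrite ltr_norml; lra.
Qed.

Lemma hitting_cvg : hitting u n%:R @[n --> \oo] --> +oo%E.
Proof.
apply/cvgeyPge => A; pose B := Num.max 0 A.
have B0 : 0 <= B by rewrite le_max lexx.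
have [m _ Hm] := EVT_max B0 (continuous_segment (lexx 0) cu).
have [M _ HM] := nbhs_infty_gtr (u m).
exists M => // n Mn; apply: (@le_trans _ _ B%:E); first by rewrite lee_fin le_max lexx orbT.
rewrite leNgt; apply/negP => /ltW /(hitting_leP _ B0).1 [s sB ns].
have := Hm s; rewrite in_itv/= => /(_ sB); have := HM n Mn; rewrite /=; lra.
Qed.

(** The maximum over [[0, t]] leaves a margin below [c]; conversely a uniform margin on all grids
    extends to every time by uniform continuity. The right-hand side is a countable condition on
    times up to [t], which makes hitting events belong to [F t]. *)
Lemma lt_hittingP c t : 0 <= t ->
  (forall s, 0 <= s <= t -> u s < c) <->
  exists m : nat, forall k i, (i <= k.+1)%N -> u (grid 0 t k i) <= c - m.+1%:R^-1.
Proof.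
move=> t0; split=> [H|[m Hm] s st].
  have [x xt Hx] := EVT_max t0 (continuous_segment (lexx 0) cu).
  have ux : 0 < c - u x by rewrite subr_gt0 H.
  have [m] := ltr_add_invr ux; rewrite add0r => Hm.
  exists m => k i ik; have := Hx (grid 0 t k i).
  rewrite in_itv/= grid_ge// grid_leT// => /(_ isT).
  by move: (_^-1) Hm => e Hm; lra.
have e0 : 0 < m.+1%:R^-1 :> R by rewrite invr_gt0.
have [k _ /(_ k (leqnn k)) H] := uniform_mesh 0 t (t - 0) cu e0.
have /andP[s0 st'] := st.
have sE0 : (0 <= s%:E)%E by rewrite lee_fin.
(* Exit from the deterministic time [s] is used only to pick a grid point within one cell of [s]. *)
have [j [jk _]] := exit_index k t0 sE0 (lexx 0).
have -> : stop t s%:E = s by rewrite /stop -EFin_min/= min_r.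
rewrite (max_r s0) => jd; have := H s (grid 0 t k j) st jd.
rewrite /= (max_r s0) max_r ?grid_ge//.
by have := Hm k j jk; rewrite ltr_norml; move: (_^-1) => e; lra.
Qed.

End continuous.
End hitting_paths.

Section localizing.
Context {d : measure_display} {T : measurableType d} {R : realType}
  (P : probability T R) (F : R -> set (set T)) (usualF : usual_conditions P F).
Implicit Types (U X : process R T) (tau : T -> \bar R).

Lemma stopping_time_min tau tau' : stopping_time F tau -> stopping_time F tau' ->
  stopping_time F (fun w => mine (tau w) (tau' w)).
Proof.
move=> [t0 tF] [t0' tF']; split=> [w|t u0]; first by rewrite le_min t0 t0'.
have sF := usual_sigma_algebra usualF u0.
rewrite (_ : [set _ | _] = [set w | (tau w <= t%:E)%E] `|` [set w | (tau' w <= t%:E)%E]).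
  have := tF t u0; have := tF' t u0; rewrite -(measurable_g_measurableTypeE sF) => h h'.
  exact: measurableU.
by apply/seteqP; split=> w /=; rewrite ge_min => /orP.
Qed.

Lemma stopping_time_hitting U (c : R) : adapted F U -> continuous_process P U ->
  stopping_time F (fun w => hitting (U ^~ w) c).
Proof.
move=> aU /continuous_processP cU; split=> [w|t t0]; first exact: hitting_ge0.
have sF := usual_sigma_algebra usualF t0.
pose C := ~` (\bigcup_m \bigcap_k \bigcap_(i in [set i | (i <= k.+1)%N])
  [set w | U (grid 0 t k i) w <= c - m.+1%:R^-1]).
apply: (@sub_ae_eq_set _ _ _ P _ sF (usual_negligible usualF t0) C).
  rewrite -(measurable_g_measurableTypeE sF) /C; apply: measurableC.
  apply: bigcupT_measurable => m; apply: bigcapT_measurable => k.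
  apply: bigcap_measurable => [|i /= ik]; first by exists 0%N.
  rewrite measurable_g_measurableTypeE//.
  rewrite (_ : [set w | _] = U (grid 0 t k i) @^-1` `]-oo, c - m.+1%:R^-1]).
    apply: (sub_measurable_preimage (adapted_leq usualF aU _ _)) => //.
      exact: grid_ge.
    exact: grid_leT.
  by apply/seteqP; split=> w; rewrite /= in_itv.
apply: filterS cU => w cw; split=> [|/= hw].
  move=> nC; apply/(hitting_leP cw _ t0); apply: contrapT => nex; apply: nC.
  have /(lt_hittingP cw _ t0)[m Hm] : forall s, 0 <= s <= t -> U s w < c.
    by move=> s st; rewrite ltNge; apply/negP => cs; apply: nex; exists s.
  by exists m => // k _ i ik; exact: Hm.
move=> [m _ Hm]; have /(hitting_leP cw _ t0)[s st cs] := hw.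
have : U s w < c.
  by apply: (lt_hittingP cw _ t0).2 st; exists m => k i ik; exact: Hm.
by rewrite ltNge cs.
Qed.

Lemma localizing_hitting U : adapted F U -> continuous_process P U ->
  localizing_sequence P F (fun n w => hitting (U ^~ w) n%:R).
Proof.
move=> aU cU; split=> [n|]; first exact: stopping_time_hitting.
move/continuous_processP : cU; apply: filterS => w cw; split; last exact: hitting_cvg.
by move=> n; apply: hitting_homo; rewrite ler_nat.
Qed.

Lemma localizing_min (tau tau' : nat -> T -> \bar R) :
  localizing_sequence P F tau -> localizing_sequence P F tau' ->
  localizing_sequence P F (fun n w => mine (tau n w) (tau' n w)).
Proof.
move=> [st cv] [st' cv']; split=> [n|]; first exact: stopping_time_min.
apply: filterS2 cv cv' => w [nd cw] [nd' cw']; split=> [n|].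
  by rewrite le_min !ge_min nd nd' orbT.
apply/cvgeyPge => A.
by move/cvgeyPge : cw => /(_ A); move/cvgeyPge : cw' => /(_ A);
  apply: filterS2 => n; rewrite le_min => -> ->.
Qed.

End localizing.

(** * Support of the Stieltjes measure and running infima *)

Section stieltjes_support.
Context {R : realType}.
Implicit Types (x l : R -> R).

Lemma lebesgue_stieltjes_ocitv (a : cumulative R R) (u v : R) : u <= v ->
  lebesgue_stieltjes_measure a `]u, v]%classic = (a v - a u)%:E.
Proof.
move=> uv; rewrite /lebesgue_stieltjes_measure /measure_extension.
by rewrite measurable_mu_extE/=; [rewrite wlength_itv_bnd|exact: is_ocitv].
Qed.

(** Without a zero of [x] in [[u, v]], the interval []u, v]] would lie in the null set while having
    mass [l v - l u > 0]. *)
Lemma stieltjes_null_touch_zero x l (a : cumulative R R) :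
  (forall t, a t = l (Num.max 0 t)) ->
  lebesgue_stieltjes_measure a [set t | 0 <= t /\ x t <> 0] = 0%E ->
  increments_touch_zero x l.
Proof.
move=> al a0 u v u0 uv luv; apply: contrapT => nz.
have : (lebesgue_stieltjes_measure a `]u, v]%classic <= 0)%E.
  rewrite -a0; apply: le_outer_measure => t /=; rewrite in_itv/= => /andP[ut tv].
  split; first exact: le_trans (ltW ut).
  by move=> xt; apply: nz; exists t => //; rewrite tv ltW.
rewrite lebesgue_stieltjes_ocitv// !al !max_r ?(le_trans u0)// lee_fin subr_le0.
by rewrite leNgt luv.
Qed.

Section converse.
Variables (x l : R -> R).
Hypotheses (x_cont : continuous (x \o Num.max 0)) (l_cont : continuous (l \o Num.max 0))
  (l_nd : forall u v : R, 0 <= u -> u <= v -> l u <= l v).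

Let a t := l (Num.max 0 t).

Let a_nd : nondecreasing a.
Proof.
move=> u v uv; apply: l_nd; first by rewrite le_max lexx.
by rewrite ge_max !le_max lexx uv orbT.
Qed.

Let a_rc : right_continuous a.
Proof. exact: right_continuousW. Qed.

HB.instance Definition _ := isCumulative.Build R _ R a a_nd a_rc.

(** By continuity every time at which [x] is nonzero lies in a rational interval where [x] has no
    zero; [l] is constant on each, and they are countably many. *)
Lemma touch_zero_stieltjes_null : increments_touch_zero x l ->
  exists2 b : cumulative R R, (forall t, b t = l (Num.max 0 t)) &
    lebesgue_stieltjes_measure b [set t | 0 <= t /\ x t <> 0] = 0%E.
Proof.
move=> xl; pose b : cumulative R R := a; exists b => //.
(* Endpoints are clipped at [0] because a rational interval around time [0] reaches negative times.
   Pairs that are not good give an empty [I p]. *)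
pose good (p : rat * rat) : Prop := ratr p.1 <= ratr p.2 :> R /\
  forall z, Num.max 0 (ratr p.1) <= z <= Num.max 0 (ratr p.2) -> x z <> 0.
pose I (p : rat * rat) : set R := [set t | good p /\ t \in `](ratr p.1), (ratr p.2)]].
pose I_ n : set R := if unpickle n is Some p then I p else set0.
have I0 n : lebesgue_stieltjes_measure b (I_ n) = 0%E.
  rewrite /I_; case: unpickle => [p|]; last by rewrite measure0.
  have [gp|ngp] := pselect (good p); last first.
    by rewrite (_ : I p = set0) ?measure0//; apply/seteqP; split=> t // [].
  rewrite (_ : I p = `](ratr p.1), (ratr p.2)]%classic).
    have [p12 nz] := gp.
    rewrite lebesgue_stieltjes_ocitv//; congr EFin; apply/eqP; rewrite subr_eq0 eq_le.
    rewrite (a_nd p12) andbT leNgt; apply/negP => lt.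
    have [||z zz xz] := xl (Num.max 0 (ratr p.1)) (Num.max 0 (ratr p.2)) _ _ lt.
    - by rewrite le_max lexx.
    - by rewrite ge_max !le_max lexx p12 orbT.
    - exact: (nz z).
  by apply/seteqP; split=> t // [].
apply/eqP; rewrite eq_le; apply/andP; split; last exact: measure_ge0.
have H0 : (\sum_(0 <= n <oo) lebesgue_stieltjes_measure b (I_ n) = 0)%E.
  by apply: eseries0 => n _ _; exact: I0.
rewrite -H0.
have := outer_measure_sigma_subadditive ((wlength b)^*)%mu I_.
apply: le_trans; apply: le_outer_measure => t /= [t0 xt].
have := @x_cont t; rewrite /continuous_at /= (max_r t0) => xc.
have ax : 0 < `|x t| by rewrite normr_gt0; apply/eqP.
have /(@cvgrPdist_lt _ R^o) /(_ _ ax) := xc.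
move=> /nbhs_ballP[r /= r0 Hr].
have tr1 : t - r < t by rewrite gtrBl.
have tr2 : t < t + r by rewrite ltrDl.
have [p] := rat_in_itvoo tr1; rewrite in_itv/= => /andP[p1 p2].
have [q] := rat_in_itvoo tr2; rewrite in_itv/= => /andP[q1 q2].
have IE : I_ (pickle (p, q)) = I (p, q) by rewrite /I_ pickleK.
exists (pickle (p, q)); first exact: Logic.I.
rewrite IE; split; last first.
  by rewrite in_itv/= p2 ltW.
split=> /=; first by rewrite ltW// (lt_trans p2).
move=> z; rewrite ge_max => /andP[/andP[z0 pz]].
rewrite (max_r (ltW (le_lt_trans t0 q1))) => zq xz.
have := Hr z; rewrite -ball_normE /= (max_r z0) xz subr0 ltxx => H.
suff : false by [].
apply: H; rewrite ltr_norml; apply/andP; split; lra.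
Qed.

End converse.
End stieltjes_support.

(** * Running infima and their logarithms *)

Section running_infimum.
Context {R : realType}.
Variables (m x : R -> R).
Hypotheses (m_gt0 : forall u : R, 0 <= u -> 0 < m u) (x_ge0 : forall u : R, 0 <= u -> 0 <= x u)
  (m_cont : continuous (m \o Num.max 0)).
Let i (u : R) := inf [set m s | s in `[0, u]].
Hypothesis xE : forall u : R, 0 <= u -> x u = m u / i u - 1.

Let has_lb u : has_lbound [set m s | s in `[0, u]].
Proof.
exists 0 => _ [s + <-]; rewrite /= in_itv/= => /andP[s0 _]; exact/ltW/m_gt0.
Qed.

Let i_le u s : 0 <= s -> s <= u -> i u <= m s.
Proof.
by move=> s0 su; apply: ge_inf => //; exists s; rewrite //= in_itv/= s0.
Qed.

Let le_i u c : 0 <= u -> (forall s, 0 <= s -> s <= u -> c <= m s) -> c <= i u.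
Proof.
move=> u0 H; apply: lb_le_inf.
  by exists (m 0); exists 0 => //=; rewrite in_itv/= lexx.
by move=> _ [s + <-]; rewrite /= in_itv/= => /andP[s0 su]; exact: H.
Qed.

(* Division by zero gives 0, so [i u = 0] would force [x u = -1 < 0]. *)
Let i_gt0 u : 0 <= u -> 0 < i u.
Proof.
move=> u0; rewrite lt_neqAle le_i ?andbT//; last by move=> s s0 _; exact/ltW/m_gt0.
apply/eqP => i0; have := x_ge0 u0; rewrite xE// -i0 invr0 mulr0; lra.
Qed.

Lemma running_inf_addE u : 0 <= u -> (1 + x u) = m u / i u.
Proof. by move=> u0; rewrite xE// addrC subrK. Qed.

(** On nonnegative times this is minus the logarithm of the running infimum; its continuity can be
    read off from this form. *)
Let l u := ln (1 + x u) - ln (m u).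

Let lE u : 0 <= u -> l u = - ln (i u).
Proof.
move=> u0; have m0 := m_gt0 u0; have i0 := i_gt0 u0.
by rewrite /l running_inf_addE// ln_div ?posrE//; ring.
Qed.

Lemma running_inf_factorization u : 0 <= u -> m u = (1 + x u) * expR (- l u).
Proof.
move=> u0; have m0 := m_gt0 u0; have i0 := i_gt0 u0.
by rewrite lE// opprK lnK ?posrE// running_inf_addE// divfK// gt_eqF.
Qed.

Lemma running_inf_log_nd u v : 0 <= u -> u <= v -> l u <= l v.
Proof.
move=> u0 uv; have v0 := le_trans u0 uv.
rewrite !lE// lerN2 ler_ln ?posrE ?i_gt0//.
by apply: le_i => // s s0 su; apply: i_le => //; exact: le_trans uv.
Qed.

Lemma running_inf_log0 : m 0 = 1 -> l 0 = 0.
Proof.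
move=> m01; rewrite lE//; suff -> : i 0 = 1 by rewrite ln1 oppr0.
apply/eqP; rewrite eq_le -m01 i_le//=.
by apply: le_i => // s s0 s1; rewrite (_ : s = 0)//; apply/eqP; rewrite eq_le s0 s1.
Qed.

(** If the infimum drops between [u] and [v], the point [z] where [m] is least on [[u, v]] lies at
    or below all earlier values; there [m] equals its running infimum and [x] vanishes. *)
Lemma running_inf_touch : increments_touch_zero x l.
Proof.
move=> u v u0 uv; have v0 := le_trans u0 uv.
rewrite !lE// ltrN2 ltr_ln ?posrE ?i_gt0// => iuv.
have [z] := EVT_min uv (continuous_segment u0 m_cont).
rewrite in_itv/= => /andP[uz zv] Hz; exists z; first by rewrite uz.
have z0 := le_trans u0 uz.
have mz : m z <= i u.
  rewrite leNgt; apply/negP => iz; move: iuv; rewrite ltNge => /negP; apply.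
  apply: le_i => // s s0 sv; have [su|us] := leP s u; first exact: i_le.
  by rewrite (le_trans (ltW iz))// Hz// in_itv/= sv ltW.
have -> : x z = m z / m z - 1.
  rewrite xE//; congr (_ / _ - 1); apply/eqP; rewrite eq_le i_le//=.
  apply: le_i => // s s0 sz; have [su|us] := leP s u.
    by rewrite (le_trans mz)// i_le.
  by rewrite Hz// in_itv/= ltW//= (le_trans sz).
by rewrite divff ?subrr// gt_eqF// m_gt0.
Qed.

Lemma running_inf_log_cont : continuous (x \o Num.max 0) -> continuous (l \o Num.max 0).
Proof.
move=> cx u; have u0 : 0 <= Num.max 0 u by rewrite le_max lexx.
have m0 := m_gt0 u0; have x0 := x_ge0 u0.
have c1 : {for u, continuous ((fun v => 1 + x (Num.max 0 v)) : R -> R)}.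
  by apply: (@cvgD _ R^o); [exact: cvg_cst|exact: cx].
have l1 : {for 1 + x (Num.max 0 u), continuous (@ln R)} by apply: continuous_ln; lra.
apply: (@cvgB _ R^o); first exact: (continuous_comp c1 l1).
exact: (continuous_comp (@m_cont u) (continuous_ln m0)).
Qed.

End running_infimum.

Section infimum_of_exponential.
Context {R : realType}.
Variables (x l : R -> R).
Hypotheses (x_ge0 : forall u : R, 0 <= u -> 0 <= x u) (x0 : x 0 = 0)
  (x_cont : continuous (x \o Num.max 0)) (l_cont : continuous (l \o Num.max 0))
  (l_nd : forall u v : R, 0 <= u -> u <= v -> l u <= l v)
  (xl : increments_touch_zero x l).

(** [e^(-l t)] is a lower bound since [1 + x >= 1] and [l] is nondecreasing. It is approached at
    zeros of [x]: the last growth of [l], from [l t - e] to [l t], must contain one. *)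
Lemma inf_exp_representation t : 0 <= t ->
  inf [set (1 + x s) * expR (- l s) | s in `[0, t]] = expR (- l t).
Proof.
move=> t0.
have lb s : 0 <= s -> s <= t -> expR (- l t) <= (1 + x s) * expR (- l s).
  move=> s0 st; rewrite (@le_trans _ _ (expR (- l s)))//.
    by rewrite ler_expR lerN2 l_nd.
  by rewrite ler_peMl ?expR_ge0// lerDl x_ge0.
apply/eqP; rewrite eq_le; apply/andP; split; last first.
  apply: lb_le_inf; first by exists ((1 + x 0) * expR (- l 0)); exists 0 => //=; rewrite in_itv/= lexx.
  by move=> _ [s + <-]; rewrite /= in_itv/= => /andP[s0 st]; exact: lb.
set I := inf _.
have H (e : R) : 0 < e -> I <= expR (e - l t).
  move=> e0.
  suff [z /andP[z0 zt] [xz lz]] : exists2 z, 0 <= z <= t & x z = 0 /\ l t - e <= l z.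
    apply: (@le_trans _ _ ((1 + x z) * expR (- l z))).
      apply: ge_inf; last by exists z => //; rewrite /= in_itv/= z0.
      by exists (expR (- l t)) => _ [s + <-]; rewrite /= in_itv/= => /andP[s0 st]; exact: lb.
    by rewrite xz addr0 mul1r ler_expR; lra.
  (* If [l] has grown by at most [e] since time [0], the zero [x 0 = 0] serves. *)
  have [l0|l0] := leP (l t - e) (l 0); first by exists 0; rewrite ?lexx.
  have l0t := l_nd (lexx 0) t0.
  have mM : Num.min (l 0) (l t) <= l t - e <= Num.max (l 0) (l t).
    by rewrite min_l// max_r//; apply/andP; split; lra.
  have [s] := IVT t0 (continuous_segment (lexx 0) l_cont) mM.
  rewrite in_itv/= => /andP[s0 st] ls.
  have [|z /andP[sz zt] xz] := xl s0 st; first by lra.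
  exists z; first by rewrite (le_trans s0 sz).
  by rewrite -ls l_nd.
rewrite leNgt; apply/negP => ltI.
have I0 : 0 < I := lt_trans (expR_gt0 _) ltI.
move: ltI; rewrite -ltr_ln ?posrE ?expR_gt0// expRK => ltI.
(* Half the gap between [ln I] and [- l t]. *)
have e0 : 0 < (l t + ln I) / 2 by lra.
have := H _ e0; rewrite -ler_ln ?posrE ?expR_gt0// expRK; lra.
Qed.
End infimum_of_exponential.

(** * Local martingales *)

Section local_martingales.
Context {d : measure_display} {T : measurableType d} {R : realType}
  (P : probability T R) (F : R -> set (set T)) (usualF : usual_conditions P F).
Implicit Types (U V X Y Z : process R T) (tau : T -> \bar R).

Lemma stopped_stopped X tau tau' : (forall w, 0 <= tau w)%E -> (forall w, 0 <= tau' w)%E ->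
  stopped (stopped X tau) tau' = stopped X (fun w => mine (tau' w) (tau w)).
Proof.
move=> t0 t0'; apply/funext => t; apply/funext => w.
by rewrite /stopped -!/(stop _ _) stop_stop.
Qed.

(** Lets two localizing sequences be merged by taking minima, at the price of optional stopping. *)
Lemma martingale_stopped_min X tau tau' : continuous_process P X ->
  stopping_time F tau -> stopping_time F tau' -> martingale P F (stopped X tau) ->
  martingale P F (stopped X (fun w => mine (tau' w) (tau w))).
Proof.
move=> cX st st' mX; rewrite -stopped_stopped; [|by case: st|by case: st'].
apply: (stopped_martingale usualF) => //.
by apply: stopped_continuous => //; case: st.
Qed.

Lemma adaptedB X Y : adapted F X -> adapted F Y -> adapted F (fun t => X t \- Y t).
Proof.
move=> aX aY t t0; have sF := usual_sigma_algebra usualF t0.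
apply/(sub_measurableP _ sF); apply: measurable_funB; apply/(sub_measurableP _ sF).
  exact: aX.
exact: aY.
Qed.

Lemma martingaleB X Y : martingale P F X -> martingale P F Y ->
  martingale P F (fun t => X t \- Y t).
Proof.
move=> mX mY; have [aX iX _] := mX; have [aY iY _] := mY.
apply: martingale_of_increment => //.
- exact: adaptedB.
- by move=> t t0; exact: (integrableB measurableT (iX _ t0) (iY _ t0)).
- move=> s t B s0 st FB; have mB := usual_measurable usualF s0 FB.
  have iB Z : martingale P F Z -> P.-integrable B (EFin \o (Z t \- Z s)).
    by move=> mZ; apply: integrableS (integrable_increment mZ s0 st).
  rewrite (eq_integral (fun w => ((X t w - X s w)%:E - (Y t w - Y s w)%:E)%E)); last first.
    by move=> w _; rewrite /= -EFinB; congr EFin; ring.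
  rewrite integralB_EFin ?iB//.
  by rewrite (martingale_increment usualF mX)// (martingale_increment usualF mY)// sube0.
Qed.

Lemma local_martingaleB X Y : continuous_local_martingale P F X ->
  continuous_local_martingale P F Y -> local_martingale P F (fun t => X t \- Y t).
Proof.
move=> [cX [aX [tau ltau mX]]] [cY [aY [tau' ltau' mY]]]; split; first exact: adaptedB.
exists (fun n w => mine (tau n w) (tau' n w)); first exact: localizing_min.
move=> n; have [[st _] [st' _]] := (ltau, ltau').
have m1 : martingale P F (stopped X (fun w => mine (tau n w) (tau' n w))).
  rewrite (_ : (fun w => _) = (fun w => mine (tau' n w) (tau n w))).
    exact: martingale_stopped_min.
  by apply/funext => w; rewrite minC.
have m2 := martingale_stopped_min cY (st' n) (st n) (mY n).
exact: martingaleB m1 m2.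
Qed.

(** The stopped martingale is nonnegative with mean zero, so it vanishes almost surely at each fixed
    time; localization, then continuity, extend this to all times at once. *)
Lemma nonneg_local_martingale_eq0 Z : continuous_local_martingale P F Z ->
  nonnegative_process P Z -> starts_at P Z 0 ->
  \forall w \ae P, forall t, 0 <= t -> Z t w = 0.
Proof.
move=> [cZ [aZ [tau [st cv] mZ]]] Z0 Z00.
have tau0 n w : (0 <= tau n w)%E by case: (st n).
have stopped0 n t : 0 <= t -> \forall w \ae P, stopped Z (tau n) t w = 0.
  move=> t0; have [aS iS _] := mZ n.
  have E0 := martingale_increment usualF (mZ n) (lexx 0) t0 (usual_setT usualF (lexx 0)).
  have mS u : 0 <= u -> measurable_fun setT (stopped Z (tau n) u).
    by move=> u0; exact: (adapted_measurable usualF).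
  have mI : measurable_fun setT (fun w => stopped Z (tau n) t w - stopped Z (tau n) 0 w).
    by apply: measurable_funB; exact: mS.
  have /(ae_eq_integral_abs P measurableT) : measurable_fun setT (EFin \o stopped Z (tau n) t).
    by apply/measurable_EFinP; exact: mS.
  move=> [H _]; have {}H : ae_eq P setT (EFin \o stopped Z (tau n) t) (cst 0%E).
    apply: H; rewrite -[RHS]E0; apply: ae_eq_integral => //.
    - by do 2 apply: measurableT_comp => //; exact: mS.
    - exact/measurable_EFinP.
    - apply: filterS2 Z0 Z00 => w Zw Z0w _ /=.
      have -> : stopped Z (tau n) 0 w = 0.
        by rewrite /stopped -/(stop _ _) stop_id.
      by rewrite subr0 ger0_norm// Zw// stop_ge0.
  by apply: filterS H => w /(_ I) [].
have modification t : 0 <= t -> \forall w \ae P, Z t w = 0.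
  move=> t0; have := ae_foralln (fun n => stopped0 n t t0).
  apply: filterS2 cv => w [_ /cvgeyPge /(_ t) [n _ /(_ n (leqnn n)) tn]] /(_ n).
  by rewrite /stopped -/(stop _ _) stop_id.
(* Countably many times that are dense in the half-line, so one null event suffices. *)
have dense : \forall w \ae P, forall N k i, Z (grid 0 N%:R k i) w = 0.
  do 3 (apply: ae_foralln => ?).
  by apply: modification; exact: grid_ge.
move/continuous_processP : cZ; apply: filterS2 dense => w Zg cw t t0.
apply/eqP; rewrite -normr_le0; apply/ler_addgt0Pr => e e0; rewrite add0r.
have [N _ /(_ N (leqnn N)) /= tN] := nbhs_infty_ger t.
have N0 : 0 <= N%:R :> R by [].
have [k _ /(_ k (leqnn k)) H] := uniform_mesh 0 N%:R (N%:R - 0) cw e0.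
have tE0 : (0 <= t%:E)%E by rewrite lee_fin.
have [j [jk _]] := exit_index k N0 tE0 (lexx 0).
have -> : stop N%:R t%:E = t by rewrite /stop -EFin_min/= min_r.
rewrite (max_r t0) => jd; have := H t (grid 0 N%:R k j).
rewrite t0 tN => /(_ isT jd).
by rewrite /= (max_r t0) max_r ?grid_ge// Zg subr0 => /ltW.
Qed.

(* Up to the time at which the control U exceeds K, the transforms and Z are
   bounded by [b K]; the convergence is required for stopped paths because the
   localizing sequence of Y has no relation to the grid. *)
Lemma riemann_local_martingale Y V Z U (b : R -> R) :
  continuous_local_martingale P F Y -> adapted F V -> continuous_process P V ->
  adapted F Z -> continuous_process P Z ->
  adapted F U -> continuous_process P U -> starts_at P U 0 ->
  (\forall w \ae P, forall r K, (0 <= r)%E ->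
    (forall t, 0 <= t -> U (stop t r) w <= K) -> forall s t, 0 <= s -> s <= t ->
    let v := fun u => V (stop u r) w in let y := fun u => Y (stop u r) w in
    [/\ `|v t| <= b K, `|Z (stop t r) w| <= b K,
        forall k, `|riemann_sum v y s t k| <= b K &
        riemann_sum v y s t k @[k --> \oo] --> Z (stop t r) w - Z (stop s r) w]) ->
  local_martingale P F Z.
Proof.
move=> [cY [aY [tau ltau mY]]] aV cV aZ cZ aU cU U0 H; split=> //.
have lU := localizing_hitting usualF aU cU.
exists (fun n w => mine (hitting (U ^~ w) n%:R) (tau n w)); first exact: localizing_min.
move=> n; pose rho w := mine (hitting (U ^~ w) n%:R) (tau n w).
have stau : stopping_time F (tau n) by case: ltau => st _; exact: st.
have sU : stopping_time F (fun w => hitting (U ^~ w) n%:R) by case: lU => sU _; exact: sU.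
have srho : stopping_time F rho := stopping_time_min usualF sU stau.
have rho0 w : (0 <= rho w)%E by case: srho.
have mYr : martingale P F (stopped Y rho) := martingale_stopped_min cY stau sU (mY n).
have {}H : \forall w \ae P, forall s t, 0 <= s -> s <= t ->
    let v := stopped V rho ^~ w in let y := stopped Y rho ^~ w in
    [/\ `|v t| <= b n%:R, `|stopped Z rho t w| <= b n%:R,
        forall k, `|riemann_sum v y s t k| <= b n%:R &
        riemann_sum v y s t k @[k --> \oo] --> stopped Z rho t w - stopped Z rho s w].
  move/continuous_processP : cU; apply: filterS3 U0 H => w U0 H cU s t s0 st.
  apply: (H (rho w)) => // u u0.
  have tau0 : (0 <= tau n w)%E by case: stau.
  (* [U] is read at the hitting time stopped at [stop u (tau n w)], where [stop_hitting_le] applies;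
     [U 0 = 0 <= n] disposes of the initial value. *)
  rewrite /rho minC -stop_stop ?hitting_ge0//.
  apply: le_trans (stop_hitting_le cU _ (stop_ge0 u0 tau0)) _.
  by rewrite U0 ge_max lexx ler0n.
apply: (@bounded_martingale_riemann_limit _ _ _ P F usualF (stopped Y rho)
   (stopped V rho) (stopped Z rho) (b n%:R) (b n%:R)) => //.
- exact: (stopped_adapted usualF aV cV srho).
- exact: (stopped_adapted usualF aZ cZ srho).
- by apply: filterS H => w H t t0; have [] := H 0 t (lexx 0) t0.
- by apply: filterS H => w H t t0; have [] := H 0 t (lexx 0) t0.
- by move=> s t s0 st; apply: filterS H => w H; have [] := H s t s0 st.
- by move=> s t s0 st; apply: filterS H => w H; have [] := H s t s0 st.
Qed.

End local_martingales.

(** * Class (Sigma) *)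

Section touching_paths.
Context {R : realType}.
Implicit Types (x l v y : R -> R) (r : \bar R).

Lemma eq_riemann_sum v v' y y' s t k : 0 <= s -> s <= t ->
  (forall u, 0 <= u -> v u = v' u) -> (forall u, 0 <= u -> y u = y' u) ->
  riemann_sum v y s t k = riemann_sum v' y' s t k.
Proof.
move=> s0 st vv yy; apply: eq_bigr => i _.
by rewrite vv ?yy// (le_trans s0)// grid_ge.
Qed.

(** A zero found between the stopped times lies at or before [r], so stopping leaves it in place; if
    [r < u] the stopped [l] has no increment. *)
Lemma increments_touch_zero_stop x l r : (0 <= r)%E -> increments_touch_zero x l ->
  increments_touch_zero (fun u => x (stop u r)) (fun u => l (stop u r)).
Proof.
move=> r0 xl u v u0 uv luv; have v0 := le_trans u0 uv.
have [z /andP[uz zv] xz] := xl _ _ (stop_ge0 u0 r0) (stop_homo u0 uv r0) luv.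
have [ur|ru] := leP u%:E r.
  rewrite (stop_id u0 ur) in uz.
  exists z; first by rewrite uz (le_trans zv)// stop_le.
  rewrite stop_id ?(le_trans u0)// (@le_trans _ _ (stop v r)%:E) ?lee_fin//.
  by rewrite EFin_stop// ge_min lexx orbT.
suff E : stop v r = stop u r by move: luv; rewrite E ltxx.
apply: EFin_inj; rewrite !EFin_stop// !min_r ?(ltW ru)//.
by rewrite (le_trans (ltW ru))// lee_fin.
Qed.

Lemma eq_increments_touch_zero x l l' : (forall u, 0 <= u -> l u = l' u) ->
  increments_touch_zero x l -> increments_touch_zero x l'.
Proof.
move=> ll xl u v u0 uv; rewrite -!ll ?(le_trans u0)//.
exact: xl.
Qed.

Lemma continuous_exp_of x l : continuous (x \o Num.max 0) -> continuous (l \o Num.max 0) ->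
  continuous ((fun u => (1 + x u) * expR (- l u)) \o Num.max 0).
Proof.
move=> cx cl u; apply: (@cvgM R R).
  by apply: (@cvgD _ R^o); [exact: cvg_cst|exact: cx].
have cNl : {for u, continuous ((fun z => - l (Num.max 0 z)) : R -> R)}.
  by apply: (@cvgN _ R^o); exact: cl.
exact: (continuous_comp cNl (@continuous_expR R _)).
Qed.

End touching_paths.

Section class_Sigma_processes.
Context {d : measure_display} {T : measurableType d} {R : realType}
  (P : probability T R) (F : R -> set (set T)) (usualF : usual_conditions P F).
Implicit Types (X L M N : process R T).

Lemma adaptedP X : adapted F X <->
  forall t, 0 <= t -> measurable_fun setT (X t : g_sigma_algebraType (F t) -> R).
Proof.
by split=> aX t t0; apply/(sub_measurableP _ (usual_sigma_algebra usualF t0)); exact: aX.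
Qed.

Section touching.
Variables (X L : process R T).
Hypotheses (aX : adapted F X) (aL : adapted F L)
  (cX : continuous_process P X) (cL : continuous_process P L)
  (X_ge0 : nonnegative_process P X) (L_nd : increasing_process P L)
  (X0 : starts_at P X 0) (L0 : starts_at P L 0)
  (XL : \forall w \ae P, increments_touch_zero (X ^~ w) (L ^~ w)).

Let adaptedD : adapted F (fun t w => X t w + L t w).
Proof.
apply/adaptedP => t t0; apply: measurable_funD.
  by move/adaptedP : aX; exact.
by move/adaptedP : aL; exact.
Qed.

Let continuousD : continuous_process P (fun t w => X t w + L t w).
Proof.
apply/continuous_processP; move/continuous_processP : cX; move/continuous_processP : cL.
by apply: filterS2 => w cl cx u; apply: (@cvgD _ R^o); [exact: cx|exact: cl].
Qed.

Let starts0D : starts_at P (fun t w => X t w + L t w) 0.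
Proof. by apply: filterS2 X0 L0 => w -> ->; rewrite addr0. Qed.

Lemma adapted_expN : adapted F (fun t w => (1 + X t w) * expR (- L t w)).
Proof.
apply/adaptedP => t t0; move/adaptedP/(_ t t0) : aX => mX; move/adaptedP/(_ t t0) : aL => mL.
apply: measurable_funM; first exact: measurable_funD.
by apply: measurableT_comp => //; exact: measurableT_comp.
Qed.

Lemma continuous_process_expN : continuous_process P (fun t w => (1 + X t w) * expR (- L t w)).
Proof.
apply/continuous_processP; move/continuous_processP : cX; move/continuous_processP : cL.
by apply: filterS2 => w cl cx; exact: continuous_exp_of.
Qed.

Let good w := [/\ continuous ((X ^~ w) \o Num.max 0), continuous ((L ^~ w) \o Num.max 0),
  forall t, 0 <= t -> 0 <= X t w,
  (forall s t, 0 <= s -> s <= t -> L s w <= L t w) &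
  L 0 w = 0 /\ increments_touch_zero (X ^~ w) (L ^~ w)].

Let ae_good : \forall w \ae P, good w.
Proof.
move/continuous_processP : cX; move/continuous_processP : cL => cL' cX'.
near=> w; split; [| | | |split]; near: w => //.
Unshelve. all: by end_near. Qed.

Let good_stop w r : good w -> (0 <= r)%E ->
  let x := fun u => X (stop u r) w in let l := fun u => L (stop u r) w in
  [/\ forall u : R, 0 <= u -> 0 <= x u, continuous (x \o Num.max 0), continuous (l \o Num.max 0),
    forall u v : R, 0 <= u -> u <= v -> l u <= l v & increments_touch_zero x l] /\
  forall u : R, 0 <= u -> 0 <= l u.
Proof.
move=> [cx cl x0 lnd [l0 xl]] r0 x l; split; last first.
  by move=> u u0; rewrite /l -l0 lnd// stop_ge0.
split.
- by move=> u u0; rewrite /x x0// stop_ge0.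
- exact: (continuous_stop r0 cx).
- exact: (continuous_stop r0 cl).
- by move=> u v u0 uv; rewrite /l lnd ?stop_ge0// stop_homo.
- exact: (increments_touch_zero_stop r0 xl).
Qed.

(** One bound for both transforms: [e^K] for the weight [e^L], [4 (1 + K)] for endpoint terms,
    [(2 + K) K] for remainders. *)
Let bound (K : R) := expR K + 4 * (1 + K) + (2 + K) * K.

Lemma local_martingale_expN N : continuous_local_martingale P F N ->
  indistinguishable P N (fun t w => X t w - L t w) ->
  local_martingale P F (fun t w => (1 + X t w) * expR (- L t w)).
Proof.
move=> cmN NE.
have aV : adapted F (fun t w => expR (- L t w)).
  apply/adaptedP => t t0; move/adaptedP/(_ t t0) : aL => mL.
  by apply: measurableT_comp => //; exact: measurableT_comp.
have cV : continuous_process P (fun t w => expR (- L t w)).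
  apply/continuous_processP; move/continuous_processP : cL; apply: filterS => w cl u.
  have cNl : {for u, continuous ((fun v => - L (Num.max 0 v) w) : R -> R)}.
  by apply: (@cvgN _ R^o); exact: cl.
  exact: (continuous_comp cNl (@continuous_expR R _)).
apply: (@riemann_local_martingale _ _ _ P F usualF N _ _
  (fun t w => X t w + L t w) bound cmN aV cV
  adapted_expN continuous_process_expN adaptedD continuousD starts0D).
apply: filterS2 ae_good NE => w gw NE r K r0 UK s t s0 st.
have t0 := le_trans s0 st.
have [[x0 cx cl lnd xl] l0] := good_stop gw r0.
have xK u : 0 <= u -> X (stop u r) w <= K.
  by move=> u0; have := UK u u0; have := l0 u u0; lra.
have lK u : 0 <= u -> L (stop u r) w <= K.
  by move=> u0; have := UK u u0; have := x0 u u0; lra.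
have K0 : 0 <= K := le_trans (x0 _ t0) (xK _ t0).
have eK := expR_gt0 K.
have [e0 e1] : 0 < expR (- L (stop t r) w) /\ expR (- L (stop t r) w) <= 1.
  by rewrite expR_gt0 expR_le1 oppr_le0 l0.
have KK : 0 <= K * K by rewrite mulr_ge0.
have RS k : riemann_sum (fun u => expR (- L (stop u r) w)) (fun u => N (stop u r) w) s t k =
    riemann_sum (fun u => expR (- L (stop u r) w))
      (fun u => X (stop u r) w - L (stop u r) w) s t k.
  by apply: eq_riemann_sum => // u u0; rewrite NE// stop_ge0.
split.
- by rewrite ger0_norm ?(ltW e0)// /bound; lra.
- have := x0 t t0; have := xK t t0 => xKt x0t.
  rewrite ger0_norm ?mulr_ge0 ?(ltW e0)//; last by lra.
  by rewrite (@le_trans _ _ (1 + X (stop t r) w)) ?ler_piMr// /bound; lra.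
- move=> k; rewrite RS.
  apply: le_trans (riemann_sum_expN_bounded x0 lnd k l0 s0 st _ (lK t t0)) _.
    by move=> u /andP[su _]; apply: xK; exact: le_trans su.
  by rewrite /bound; lra.
- under eq_fun do rewrite RS.
  exact: (riemann_sum_expN_cvg x0 cx cl lnd xl l0 s0 st).
Qed.

(** The weight [e^L] inverts the weight [e^(-L)] of the direct transform; while [L <= K] it stays
    below [e^K]. *)
Lemma local_martingale_sub M : continuous_local_martingale P F M ->
  indistinguishable P M (fun t w => (1 + X t w) * expR (- L t w)) ->
  local_martingale P F (fun t => X t \- L t).
Proof.
move=> cmM ME.
have aV : adapted F (fun t w => expR (L t w)).
  apply/adaptedP => t t0; move/adaptedP/(_ t t0) : aL => mL.
  exact: measurableT_comp.
have cV : continuous_process P (fun t w => expR (L t w)).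
  apply/continuous_processP; move/continuous_processP : cL; apply: filterS => w cl u.
  exact: (continuous_comp (@cl u) (@continuous_expR R _)).
have cZ : continuous_process P (fun t => X t \- L t).
  apply/continuous_processP; move/continuous_processP : cX; move/continuous_processP : cL.
  by apply: filterS2 => w cl cx u; apply: (@cvgB _ R^o); [exact: cx|exact: cl].
apply: (@riemann_local_martingale _ _ _ P F usualF M _ _
  (fun t w => X t w + L t w) bound cmM aV cV
  (adaptedB usualF aX aL) cZ adaptedD continuousD starts0D).
apply: filterS2 ae_good ME => w gw ME r K r0 UK s t s0 st.
have t0 := le_trans s0 st.
have [[x0 cx cl lnd xl] l0] := good_stop gw r0.
have xK u : 0 <= u -> X (stop u r) w <= K.
  by move=> u0; have := UK u u0; have := l0 u u0; lra.
have lK u : 0 <= u -> L (stop u r) w <= K.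
  by move=> u0; have := UK u u0; have := x0 u u0; lra.
have K0 : 0 <= K := le_trans (x0 _ t0) (xK _ t0).
have eK := expR_gt0 K.
have KK : 0 <= K * K by rewrite mulr_ge0.
have RS k : riemann_sum (fun u => expR (L (stop u r) w)) (fun u => M (stop u r) w) s t k =
    riemann_sum (fun u => expR (L (stop u r) w)) 
      (fun u => (1 + X (stop u r) w) * expR (- L (stop u r) w)) s t k.
  by apply: eq_riemann_sum => // u u0; rewrite ME// stop_ge0.
split.
- rewrite ger0_norm ?expR_ge0// (@le_trans _ _ (expR K)) ?ler_expR ?lK// /bound; lra.
- have := x0 t t0; have := xK t t0; have := l0 t t0; have := lK t t0 => ? ? ? ?.
  by rewrite ler_norml /bound /=; apply/andP; split; lra.
- move=> k; rewrite RS.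
  apply: le_trans (riemann_sum_exp_bounded x0 lnd k l0 s0 st _ (lK t t0)) _.
    by move=> u /andP[su _]; apply: xK; exact: le_trans su.
  by rewrite /bound; lra.
- under eq_fun do rewrite RS.
  exact: (riemann_sum_exp_cvg x0 cx cl lnd xl s0 st).
Qed.

End touching.
End class_Sigma_processes.

Section uniqueness.
Context {d : measure_display} {T : measurableType d} {R : realType}
  (P : probability T R) (F : R -> set (set T)) (usualF : usual_conditions P F).
Implicit Types (X L M N : process R T).

(** The control [A + L] bounds both the size of [Y = A - L] and its variation, hence the sums of [Y]
    against itself, which tend to the increment of [Y^2 / 2]. *)
Lemma increasing_parts_eq N N' A L : continuous_local_martingale P F N ->
  continuous_local_martingale P F N' ->
  adapted F A -> adapted F L -> continuous_process P A -> continuous_process P L ->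
  increasing_process P A -> increasing_process P L ->
  starts_at P A 0 -> starts_at P L 0 ->
  indistinguishable P (fun t => N t \+ A t) (fun t => N' t \+ L t) ->
  indistinguishable P A L.
Proof.
move=> cmN cmN' aA aL cA cL A_nd L_nd A0 L0 NN'.
pose Y : process R T := fun t => N' t \- N t.
have YE : indistinguishable P Y (fun t => A t \- L t).
  by apply: filterS NN' => w H t t0; have := H t t0; rewrite /Y /=; lra.
have aY : adapted F Y := adaptedB usualF cmN'.2.1 cmN.2.1.
have cY : continuous_process P Y.
  case: cmN cmN' => /continuous_processP cN _ [/continuous_processP cN' _].
  apply/continuous_processP; apply: filterS2 cN cN' => w cw cw' u.
  by apply: (@cvgB _ R^o); [exact: cw'|exact: cw].
have cmY : continuous_local_martingale P F Y by split => //; exact: local_martingaleB.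
pose Z : process R T := fun t w => Y t w ^+ 2 / 2.
have aZ : adapted F Z.
  apply/(adaptedP usualF) => t t0; move/(adaptedP usualF)/(_ t t0) : aY => mY.
  by apply: measurable_funM => //; exact: measurable_funX.
have cZ : continuous_process P Z.
  apply/continuous_processP; move/continuous_processP : cY; apply: filterS => w cw u.
  apply: (@cvgM R R); last exact: cvg_cst.
  by apply: (@cvgM R R); exact: cw.
have aU : adapted F (fun t w => A t w + L t w).
  apply/(adaptedP usualF) => t t0; apply: measurable_funD.
    by move/(adaptedP usualF) : aA; exact.
  by move/(adaptedP usualF) : aL; exact.
have cU : continuous_process P (fun t w => A t w + L t w).
  apply/continuous_processP; move/continuous_processP : cA; move/continuous_processP : cL.
  by apply: filterS2 => w cl cx u; apply: (@cvgD _ R^o); [exact: cx|exact: cl].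
have U0 : starts_at P (fun t w => A t w + L t w) 0.
  by apply: filterS2 A0 L0 => w -> ->; rewrite addr0.
have mZ : local_martingale P F Z.
  apply: (@riemann_local_martingale _ _ _ P F usualF Y Y Z (fun t w => A t w + L t w)
    (* The quadratic term covers the sums and [Z], the linear term the weight [Y]. *)
    (fun K => K ^+ 2 * 2 + K) cmY aY cY aZ cZ aU cU U0).
  have /continuous_processP cY' := cY.
  near=> w => r K r0 UK s t s0 st.
  have t0 := le_trans s0 st.
  have A0w : A 0 w = 0 by near: w; exact: A0.
  have L0w : L 0 w = 0 by near: w; exact: L0.
  have A_ndw : forall s t, 0 <= s -> s <= t -> A s w <= A t w by near: w; exact: A_nd.
  have L_ndw : forall s t, 0 <= s -> s <= t -> L s w <= L t w by near: w; exact: L_nd.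
  have cw : continuous ((Y ^~ w) \o Num.max 0) by near: w; exact: cY'.
  have YEw : forall t, 0 <= t -> Y t w = A t w - L t w by near: w; exact: YE.
  pose y u := Y (stop u r) w; pose a u := A (stop u r) w; pose l u := L (stop u r) w.
  have cy : continuous (y \o Num.max 0) := continuous_stop r0 cw.
  have yE u : 0 <= u -> y u = a u - l u by move=> u0; rewrite /y YEw// stop_ge0.
  have a_nd u v : 0 <= u -> u <= v -> a u <= a v.
    by move=> u0 uv; rewrite /a A_ndw ?stop_ge0// stop_homo.
  have l_nd u v : 0 <= u -> u <= v -> l u <= l v.
    by move=> u0 uv; rewrite /l L_ndw ?stop_ge0// stop_homo.
  have a0 u : 0 <= u -> 0 <= a u by move=> u0; rewrite /a -A0w A_ndw// stop_ge0.
  have l0 u : 0 <= u -> 0 <= l u by move=> u0; rewrite /l -L0w L_ndw// stop_ge0.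
  have alK u : 0 <= u -> a u + l u <= K by move=> u0; exact: UK.
  have yK u : 0 <= u -> `|y u| <= K.
    by move=> u0; rewrite yE// ler_norml; have := a0 u u0; have := l0 u u0; have := alK u u0; lra.
  have K0 : 0 <= K by have := yK t t0; apply: le_trans.
  have KK : 0 <= K ^+ 2 by rewrite sqr_ge0.
  rewrite -/(y t) /Z -/(y t) -/(y s) -/y; split.
  - by rewrite (le_trans (yK t t0))//; lra.
  - rewrite normrM normrX (ger0_norm (_ : 0 <= 2^-1 :> R))//.
    have : `|y t| ^+ 2 <= K ^+ 2 by rewrite ler_pXn2r ?nnegrE ?yK.
    by lra.
  - move=> k; apply: le_trans (riemann_sum_self_bounded (K := K) yE a_nd l_nd k s0 st _ _) _.
    + by move=> u /andP[su _]; apply: yK; exact: le_trans su.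
    + by have := alK t t0; have := a0 s s0; have := l0 s s0; lra.
    + by rewrite lerDl.
  - exact: (riemann_sum_self_cvg cy yE a_nd l_nd s0 st).
have Z0 : \forall w \ae P, forall t, 0 <= t -> Z t w = 0.
  apply: (nonneg_local_martingale_eq0 usualF (conj cZ mZ)).
    by apply: aeW => w t _; rewrite /Z divr_ge0// sqr_ge0.
  by apply: filterS3 YE A0 L0 => w H A0w L0w; rewrite /Z H//= A0w L0w subrr expr0n mul0r.
apply: filterS2 YE Z0 => w YEw Zw t t0.
have := Zw t t0; rewrite /Z => /eqP; rewrite mulf_eq0 invr_eq0 pnatr_eq0 orbF sqrf_eq0.
by rewrite YEw//= subr_eq0 => /eqP.
Unshelve. all: by end_near. Qed.

End uniqueness.

(** * The two implications *)

Section representation.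
Context {d : measure_display} {T : measurableType d} {R : realType}
  (P : probability T R) (F : R -> set (set T)) (usualF : usual_conditions P F)
  (X N A : process R T).
Hypotheses (X_ge0 : nonnegative_process P X) (X_cont : continuous_process P X)
  (X_submart : local_submartingale P F X) (X_0 : starts_at P X 0)
  (X_dec : decomposition P F X N A).

Let X_adapted : adapted F X := X_submart.1.

Lemma class_Sigma_representation :
  (\forall w \ae P, increments_touch_zero (X ^~ w) (A ^~ w)) ->
  inf_representation P F X (fun t w => (1 + X t w) * expR (- A t w)).
Proof.
move=> XA; case: X_dec => XE mN aA cA A_nd A0.
have cM := continuous_process_expN X_cont cA.
have NE : indistinguishable P N (fun t w => X t w - A t w).
  by apply: filterS XE => w H t t0; rewrite H//= addrK.
split.
- by apply: filterS X_ge0 => w x0 t t0; rewrite mulr_gt0 ?expR_gt0// ltr_pwDl// x0.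
- split=> //.
  exact: (local_martingale_expN usualF X_adapted aA X_cont cA X_ge0 A_nd X_0 A0 XA mN NE).
- by apply: filterS2 X_0 A0 => w -> ->; rewrite oppr0 expR0 addr0 mulr1.
- have /continuous_processP cX' := X_cont; have /continuous_processP cA' := cA.
  near=> w => t t0.
  have -> : running_inf (fun t w => (1 + X t w) * expR (- A t w)) t w = expR (- A t w).
    apply: (@inf_exp_representation _ (X ^~ w) (A ^~ w)) => //; near: w => //.
  by rewrite mulfK ?gt_eqF ?expR_gt0//= addrC addKr.
Unshelve. all: by end_near. Qed.

Lemma representation_class_Sigma M : inf_representation P F X M ->
  (\forall w \ae P, increments_touch_zero (X ^~ w) (A ^~ w)) /\
  indistinguishable P M (fun t w => (1 + X t w) * expR (- A t w)).
Proof.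
move=> [M_gt0 [cM mM] M1 ME]; case: X_dec => XE mN aA cA A_nd A0.
(* Written with [X] and [M] at time [t] only, [L] is visibly adapted; the infimum over uncountably
   many times is not. *)
pose L : process R T := fun t w => ln (1 + X t w) - ln (M t w).
have aM : adapted F M := mM.1.
have aL : adapted F L.
  apply/(adaptedP usualF) => t t0.
  move/(adaptedP usualF)/(_ t t0) : X_adapted => mX.
  move/(adaptedP usualF)/(_ t t0) : aM => mMt.
  apply: measurable_funB; apply: measurableT_comp => //.
  exact: measurable_funD.
have /continuous_processP cX' := X_cont; have /continuous_processP cM' := cM.
have cL : continuous_process P L.
  apply/continuous_processP; near=> w.
  by apply: (@running_inf_log_cont R (M ^~ w) (X ^~ w)); near: w.
have L_nd : increasing_process P L.
  near=> w => s t.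
  by apply: (@running_inf_log_nd R (M ^~ w) (X ^~ w)); near: w.
have L0 : starts_at P L 0.
  near=> w.
  by apply: (@running_inf_log0 R (M ^~ w) (X ^~ w)); near: w.
have XL : \forall w \ae P, increments_touch_zero (X ^~ w) (L ^~ w).
  near=> w.
  by apply: (@running_inf_touch R (M ^~ w) (X ^~ w)); near: w.
have MLE : indistinguishable P M (fun t w => (1 + X t w) * expR (- L t w)).
  near=> w => t t0.
  by apply: (@running_inf_factorization R (M ^~ w) (X ^~ w)) => //; near: w.
have mXL : continuous_local_martingale P F (fun t => X t \- L t).
  split; last first.
    exact: (local_martingale_sub usualF X_adapted aL X_cont cL
       X_ge0 L_nd X_0 L0 XL (conj cM mM) MLE).
  apply/continuous_processP; have /continuous_processP cL' := cL.
  by apply: filterS2 cX' cL' => w cx cl u; apply: (@cvgB _ R^o); [exact: cx|exact: cl].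
have AL : indistinguishable P A L.
  apply: (increasing_parts_eq usualF mN mXL) => //.
  by apply: filterS XE => w H t t0; rewrite /= -H// subrK.
split.
  apply: filterS2 AL XL => w ALw; apply: eq_increments_touch_zero => u u0.
  by rewrite ALw.
by apply: filterS2 AL MLE => w ALw Mw t t0; rewrite ALw// Mw.
Unshelve. all: by end_near. Qed.

End representation.

Theorem proposition2p4 (R : realType) (d : measure_display)
    (T : measurableType d) (P : probability T R) (F : R -> set (set T))
    (X N A : process R T)
    (usualF : usual_conditions P F)
    (X_ge0 : nonnegative_process P X)
    (X_cont : continuous_process P X)
    (X_submart : local_submartingale P F X)
    (X_0 : starts_at P X 0)
    (X_dec : decomposition P F X N A) :
  (class_Sigma P F X N A <->
   exists M : process R T, inf_representation P F X M /\
     forall M' : process R T,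
       inf_representation P F X M' -> indistinguishable P M' M) /\
  (forall M : process R T, inf_representation P F X M ->
     indistinguishable P M (fun t w => (1 + X t w) * expR (- A t w))).
Proof.
have rep :=
  representation_class_Sigma usualF X_ge0 X_cont X_submart X_0 X_dec.
split; last by move=> M /rep[].
split=> [[_ _ _ _ XA]|[M [/rep[XA _] _]]].
  exists (fun t w => (1 + X t w) * expR (- A t w)); split; last by move=> M /rep[].
  apply: (class_Sigma_representation usualF X_ge0 X_cont X_submart X_0 X_dec).
  by apply: filterS XA => w [a aE a0]; exact: (stieltjes_null_touch_zero aE a0).
case: (X_dec) => XE mN aA cA A_nd A0.
split=> //.
  (* [N] starts at [0] because [X] and [A] do. *)
  near=> w.
  have XEw : forall t, 0 <= t -> X t w = N t w + A t w by near: w; exact: XE.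
  have X0w : X 0 w = 0 by near: w; exact: X_0.
  have A0w : A 0 w = 0 by near: w; exact: A0.
  by have := XEw 0 (lexx 0); lra.
have /continuous_processP cX' := X_cont; have /continuous_processP cA' := cA.
near=> w.
by apply: (@touch_zero_stieltjes_null R (X ^~ w) (A ^~ w)); near: w.
Unshelve. all: by end_near. Qed.
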